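(* No countable $M\models\mathsf{ZFC}$ has a least $\mathsf{KM}$-realization. Moreover, if $k\ge1$ is a natural number then no countable $M\models\mathsf{ZFC}$ has a least $(\mathsf{GBC}+\Pi^1_k\text{-}\mathsf{CA})$-realization.
   Context: Second-order set theory is formalized in two-sorted first-order logic (sets and classes). A model is a pair $(M,\mathcal X)$ with $M$ the universe of sets (possibly ill-founded) and $\mathcal X\subseteq\mathcal P(M)$ the classes. A formula is first-order if it has no class quantifiers; a $\Pi^1_k$ formula has $k$ alternating blocks of class quantifiers, starting with $\forall$, in front of a first-order formula. $\mathsf{GBC}$: $\mathsf{ZFC}$ for sets, Extensionality for classes, Class Replacement, Global Choice (a class bijection $\mathrm{Ord}\to V$), and Elementary Comprehension (Comprehension for first-order formulas with set and class parameters). $\Pi^1_k\text{-}\mathsf{CA}$: Comprehension for $\Pi^1_k$ formulas with parameters. $\mathsf{KM}$: $\mathsf{GBC}$ plus Comprehension for all formulas. A $T$-realization for $M$ is a set $\mathcal X\subseteq\mathcal P(M)$ with $(M,\mathcal X)\models T$. The least $T$-realization for $M$, if it exists, is the $T$-realization $\mathcal X$ for $M$ so that $\mathcal X\subseteq\mathcal Y$ for every $T$-realization $\mathcal Y$ for $M$. *)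

(* Defs.v *)
From mathcomp Require Import all_boot.
From mathcomp Require Import boolp classical_sets cardinality.

Set Implicit Arguments.
Unset Strict Implicit.
Unset Printing Implicit Defensive.

Local Open Scope classical_set_scope.

(* Formulas are interpreted classically, so falsity, implication and the
   quantifiers give the full expressive power of first-order logic.  Variables
   are de Bruijn indices, with independent numberings for sets and classes. *)

Inductive set_formula : Type :=
| SMem (i j : nat)
| SEq (i j : nat)
| SFalse
| SImp (phi psi : set_formula)
| SAll (phi : set_formula)
| SEx (phi : set_formula).

Inductive formula : Type :=
| Mem (i j : nat)           (* set i belongs to set j *)
| Eq (i j : nat)
| ClassMem (i j : nat)      (* set i belongs to class j *)
| ClassEq (i j : nat)
| False_
| Imp (phi psi : formula)
| All (phi : formula)
| Ex (phi : formula)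
| ClassAll (phi : formula)
| ClassEx (phi : formula).

Fixpoint first_order (phi : formula) : bool :=
  match phi with
  | Mem _ _ | Eq _ _ | ClassMem _ _ | ClassEq _ _ | False_ => true
  | Imp phi psi => first_order phi && first_order psi
  | All phi | Ex phi => first_order phi
  | ClassAll _ | ClassEx _ => false
  end.

(* Each quantifier block is a nonempty string of like quantifiers. *)
Inductive Pi1 : nat -> formula -> Prop :=
| Pi1_0 phi : first_order phi -> Pi1 0 phi
| Pi1_S k n phi : Sigma1 k phi -> Pi1 k.+1 (iter n.+1 ClassAll phi)
with Sigma1 : nat -> formula -> Prop :=
| Sigma1_0 phi : first_order phi -> Sigma1 0 phi
| Sigma1_S k n phi : Pi1 k phi -> Sigma1 k.+1 (iter n.+1 ClassEx phi).

Definition scons (T : Type) (a : T) (v : nat -> T) (n : nat) : T :=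
  if n is m.+1 then v m else a.

(* A structure for sets is a type M with an arbitrary (possibly ill-founded)
   binary relation E; the axioms that are single sentences are written out as
   their truth value in the structure. *)
Section SetTheory.
Variables (M : Type) (E : M -> M -> Prop).

Local Notation "x ∈ y" := (E x y) (at level 70).

Fixpoint set_sat (v : nat -> M) (phi : set_formula) : Prop :=
  match phi with
  | SMem i j => v i ∈ v j
  | SEq i j => v i = v j
  | SFalse => False
  | SImp phi psi => set_sat v phi -> set_sat v psi
  | SAll phi => forall a, set_sat (scons a v) phi
  | SEx phi => exists a, set_sat (scons a v) phi
  end.

Definition subset_of (x y : M) : Prop := forall z, z ∈ x -> z ∈ y.

Definition nonempty_set (x : M) : Prop := exists z, z ∈ x.

Definition is_upair (p x y : M) : Prop := forall z, z ∈ p <-> z = x \/ z = y.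

(* Kuratowski pair *)
Definition is_pair (p x y : M) : Prop :=
  forall z, z ∈ p <-> is_upair z x x \/ is_upair z x y.

Definition extensionality : Prop :=
  forall x y, (forall z, z ∈ x <-> z ∈ y) -> x = y.

Definition foundation : Prop :=
  forall x, nonempty_set x -> exists y, y ∈ x /\ forall z, z ∈ x -> ~ z ∈ y.

Definition pairing : Prop := forall x y, exists p, is_upair p x y.

Definition union : Prop :=
  forall x, exists u, forall z, z ∈ u <-> exists y, y ∈ x /\ z ∈ y.

Definition powerset : Prop :=
  forall x, exists p, forall z, z ∈ p <-> subset_of z x.

Definition infinity : Prop :=
  exists w, (exists e, e ∈ w /\ ~ nonempty_set e) /\
    forall x, x ∈ w ->
      exists y, y ∈ w /\ forall z, z ∈ y <-> z ∈ x \/ z = x.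

Definition separation : Prop :=
  forall (phi : set_formula) (v : nat -> M) (a : M),
    exists b, forall x, x ∈ b <-> x ∈ a /\ set_sat (scons x v) phi.

(* In phi, variable 0 is the argument and variable 1 the value. *)
Definition replacement : Prop :=
  forall (phi : set_formula) (v : nat -> M) (a : M),
    let R x y := set_sat (scons x (scons y v)) phi in
    (forall x y y', x ∈ a -> R x y -> R x y' -> y = y') ->
    exists b, forall y, y ∈ b <-> exists x, x ∈ a /\ R x y.

Definition choice : Prop :=
  forall a,
    (forall x, x ∈ a -> nonempty_set x) ->
    (forall x y z, x ∈ a -> y ∈ a -> z ∈ x -> z ∈ y -> x = y) ->
    exists c, forall x, x ∈ a -> exists! z, z ∈ x /\ z ∈ c.

Record ZFC : Prop := {
  ZFC_extensionality : extensionality;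
  ZFC_foundation : foundation;
  ZFC_pairing : pairing;
  ZFC_union : union;
  ZFC_powerset : powerset;
  ZFC_infinity : infinity;
  ZFC_separation : separation;
  ZFC_replacement : replacement;
  ZFC_choice : choice
}.

(* Transitive and strictly well-ordered by membership, in the sense of M. *)
Definition is_ordinal (x : M) : Prop :=
  [/\ forall y, y ∈ x -> subset_of y x,
      forall y, y ∈ x -> ~ y ∈ y,
      forall y z w, y ∈ x -> z ∈ x -> w ∈ x -> y ∈ z -> z ∈ w -> y ∈ w,
      forall y z, y ∈ x -> z ∈ x -> [\/ y ∈ z, y = z | z ∈ y] &
      forall s, subset_of s x -> nonempty_set s ->
        exists m, m ∈ s /\ forall y, y ∈ s -> m = y \/ m ∈ y].

Definition class_rel (F : set M) (x y : M) : Prop :=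
  exists p, is_pair p x y /\ F p.

Definition class_function (F : set M) : Prop :=
  (forall p, F p -> exists x y, is_pair p x y) /\
  (forall x y y', class_rel F x y -> class_rel F x y' -> y = y').

Section Classes.
Variable X : set (set M).

Fixpoint sat (v : nat -> M) (V : nat -> set M) (phi : formula) : Prop :=
  match phi with
  | Mem i j => v i ∈ v j
  | Eq i j => v i = v j
  | ClassMem i j => V j (v i)
  | ClassEq i j => V i = V j
  | False_ => False
  | Imp phi psi => sat v V phi -> sat v V psi
  | All phi => forall a, sat (scons a v) V phi
  | Ex phi => exists a, sat (scons a v) V phi
  | ClassAll phi => forall A, X A -> sat v (scons A V) phi
  | ClassEx phi => exists A, X A /\ sat v (scons A V) phi
  end.

(* v and V supply the set and class parameters. *)
Definition comprehension (Phi : formula -> Prop) : Prop :=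
  forall phi, Phi phi ->
  forall (v : nat -> M) (V : nat -> set M), (forall n, X (V n)) ->
    X [set a | sat (scons a v) V phi].

Definition class_extensionality : Prop :=
  forall A B, X A -> X B -> (forall x, A x <-> B x) -> A = B.

Definition class_replacement : Prop :=
  forall F, X F -> class_function F ->
  forall a, exists b, forall y, y ∈ b <-> exists x, x ∈ a /\ class_rel F x y.

Definition global_choice : Prop :=
  exists F, [/\ X F, class_function F,
    forall x, (exists y, class_rel F x y) <-> is_ordinal x,
    forall x x' y, class_rel F x y -> class_rel F x' y -> x = x' &
    forall y, exists x, class_rel F x y].

Record GBC : Prop := {
  GBC_ZFC : ZFC;
  GBC_extensionality : class_extensionality;
  GBC_replacement : class_replacement;
  GBC_global_choice : global_choice;
  GBC_comprehension : comprehension first_order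
}.

Definition GBC_Pi1_CA (k : nat) : Prop := GBC /\ comprehension (Pi1 k).

Definition KM : Prop := GBC /\ comprehension (fun _ => True).

End Classes.

(* T X says that (M, X) is a model of the theory in question. *)
Definition least_realization (T : set (set M) -> Prop) (X : set (set M)) :
    Prop :=
  T X /\ forall Y, T Y -> X `<=` Y.

End SetTheory.

(* Main.v *)
From mathcomp Require Import all_boot.
From mathcomp Require Import boolp classical_sets cardinality.
Require Import Defs.

(* Given a realization X contained in every realization, a game inside M is set
   up whose positions are sets of coded truth values for formulas about named
   classes.  A position is live if the player can answer all challenges forever.
   A realization gives a winning strategy, and as M is countable a generic play
   from a live position yields a realization.  The challenges only reach
   formulas built up step by step, so no well-foundedness of M is needed.
   A class A of X lies in every realization, hence cannot be avoided by
   generic plays: some live position s and name i are such that s together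
   with a wrong answer to "is m in class i" is never live, for any m.
   Liveness is not expressible in (M, X), but it can be compared: the largest
   simulation between positions is a union of classes of X, so it is in X by
   Pi^1_1 comprehension; it transfers liveness from s to t when (s, t) is in it,
   and from t to s when it is not.  Let A be the class of all c = (s, i) such
   that s + "c is not in i" is not simulated by s + "c is in i".  A pair (s, i)
   that isolates A yields a contradiction at m = (s, i). *)

Set Implicit Arguments.
Unset Strict Implicit.
Unset Printing Implicit Defensive.

Local Open Scope classical_set_scope.

(** * Syntax *)

Lemma scons_comp (T U : Type) (h : T -> U) a (v : nat -> T) :
  (fun n => h (scons a v n)) = scons (h a) (fun n => h (v n)).
Proof. by apply: funext; case. Qed.

Definition up_ren (f : nat -> nat) : nat -> nat := scons 0 (fun n => (f n).+1).

Lemma scons_up_ren (T : Type) (a : T) v f :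
  (fun n => scons a v (up_ren f n)) = scons a (fun n => v (f n)).
Proof. by apply: funext; case. Qed.

Fixpoint rename (f g : nat -> nat) (phi : formula) : formula :=
  match phi with
  | Mem i j => Mem (f i) (f j)
  | Eq i j => Eq (f i) (f j)
  | ClassMem i j => ClassMem (f i) (g j)
  | ClassEq i j => ClassEq (g i) (g j)
  | False_ => False_
  | Imp phi psi => Imp (rename f g phi) (rename f g psi)
  | All phi => All (rename (up_ren f) g phi)
  | Ex phi => Ex (rename (up_ren f) g phi)
  | ClassAll phi => ClassAll (rename f (up_ren g) phi)
  | ClassEx phi => ClassEx (rename f (up_ren g) phi)
  end.

Lemma rename_first_order phi : forall f g,
  first_order (rename f g phi) = first_order phi.
Proof. by elim: phi => //= p IHp q IHq f g; rewrite IHp IHq. Qed.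

(* Formulas whose de Bruijn indices are always 0 or 1; explicit structural
   operations on assignments ([Sw] swaps the first two sets, [W1] and [W2] drop
   the first set and the first class) take the place of other indices, so that
   evaluating a coded formula needs no recursion on indices inside a model. *)
Inductive sform : Type :=
| SM | SC | SF
| SI (phi psi : sform)
| SA (phi : sform)
| SCA (phi : sform)
| Sw (phi : sform)
| W1 (phi : sform)
| W2 (phi : sform).

Definition swap_env (T : Type) (v : nat -> T) : nat -> T :=
  scons (v 1) (scons (v 0) (fun n => v n.+2)).

Definition sneg phi := SI phi SF.
Definition sand phi psi := sneg (SI phi (sneg psi)).
Definition siff phi psi := sand (SI phi psi) (SI psi phi).

(** The comprehension axiom for [phi]; [W2] hides the newly quantified class, so [phi] cannot refer
    to the class it defines. *)
Definition scomp phi := sneg (SCA (sneg (SA (siff SC (W2 phi))))).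

(* Grade 0 is the class of all formulas, grade 1 the first-order ones and grade
   [k.+1] corresponds to [Pi1 k]. *)
Inductive graded : nat -> sform -> Prop :=
| Gr_SM g : g <= 1 -> graded g SM
| Gr_SC g : g <= 1 -> graded g SC
| Gr_SF g : g <= 1 -> graded g SF
| Gr_SI g phi psi : g <= 1 -> graded g phi -> graded g psi ->
    graded g (SI phi psi)
| Gr_SA g phi : g <= 1 -> graded g phi -> graded g (SA phi)
| Gr_Sw g phi : g <= 1 -> graded g phi -> graded g (Sw phi)
| Gr_W1 g phi : g <= 1 -> graded g phi -> graded g (W1 phi)
| Gr_W2 g phi : g <= 1 -> graded g phi -> graded g (W2 phi)
| Gr_SCA phi : graded 0 phi -> graded 0 (SCA phi)
| Gr_block g phi : graded g.+1 phi -> graded g.+2 (SCA (sneg phi))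
| Gr_more g phi : graded g.+2 phi -> graded g.+2 (SCA phi).

(** [Sw (W1 phi)] discards variable 1 and keeps variable 0, so iterating it brings a distant
    variable next to variable 0. Equal indices end in [SF], which is right because membership is
    irreflexive. *)
Fixpoint tr_mem (i j : nat) : sform :=
  match i, j with
  | 0, 0 => SF
  | 0, j.+1 => iter j (fun phi => Sw (W1 phi)) SM
  | i.+1, 0 => iter i (fun phi => Sw (W1 phi)) (Sw SM)
  | i.+1, j.+1 => W1 (tr_mem i j)
  end.

(** Equality is replaced by having the same members: exact for sets by Extensionality, and for
    classes because they are subsets of [M]. *)
Fixpoint tr (phi : formula) : sform :=
  match phi with
  | Mem i j => tr_mem i j
  | Eq i j => SA (siff (tr_mem 0 i.+1) (tr_mem 0 j.+1))
  | ClassMem i j => iter i W1 (iter j W2 SC)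
  | ClassEq i j => SA (siff (iter i W2 SC) (iter j W2 SC))
  | False_ => SF
  | Imp phi psi => SI (tr phi) (tr psi)
  | All phi => SA (tr phi)
  | Ex phi => sneg (SA (sneg (tr phi)))
  | ClassAll phi => SCA (tr phi)
  | ClassEx phi => sneg (SCA (sneg (tr phi)))
  end.

Definition swap_ren (n : nat) : nat :=
  match n with 0 => 1 | 1 => 0 | _ => n end.

Fixpoint back (phi : sform) : formula :=
  match phi with
  | SM => Mem 0 1
  | SC => ClassMem 0 0
  | SF => False_
  | SI phi psi => Imp (back phi) (back psi)
  | SA phi => All (back phi)
  | SCA phi => ClassAll (back phi)
  | Sw phi => rename swap_ren id (back phi)
  | W1 phi => rename succn id (back phi)
  | W2 phi => rename id succn (back phi)
  end.

Lemma graded0 phi : graded 0 phi.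
Proof. by elim: phi => *; constructor. Qed.

Lemma graded_iter F phi n : (forall psi, graded 1 psi -> graded 1 (F psi)) ->
  graded 1 phi -> graded 1 (iter n F phi).
Proof. by move=> HF Hphi; elim: n => //= n; apply: HF. Qed.

Lemma graded_tr_mem i j : graded 1 (tr_mem i j).
Proof.
elim: i j => [|i IH] [|j] /=; try by constructor.
- by apply: graded_iter => [psi Hpsi|]; do ?constructor.
- by apply: graded_iter => [psi Hpsi|]; do ?constructor.
Qed.

Lemma graded_tr phi : first_order phi -> graded 1 (tr phi).
Proof.
have Hmem j : graded 1 (tr_mem 0 j.+1) by apply: graded_tr_mem.
have HW2 j : graded 1 (iter j W2 SC).
  by apply: graded_iter => [psi|]; constructor.
elim: phi => //=.
- by move=> i j _; apply: graded_tr_mem.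
- by move=> i j _; do !constructor => //; apply: (Hmem _).
- by move=> i j _; apply: graded_iter => [psi|//]; constructor.
- by move=> i j _; do !constructor.
- by move=> *; constructor.
- by move=> p IHp q IHq /andP[/IHp ? /IHq ?]; constructor.
- by move=> p IHp /IHp ?; constructor.
- by move=> p IHp /IHp ?; do !constructor.
Qed.

Lemma back_first_order phi : graded 1 phi -> first_order (back phi).
Proof.
move: {-2}1 (erefl 1) => g Hg H; elim: H Hg => //=.
- by move=> h p q _ _ IHp _ IHq Hg; rewrite IHp // IHq.
- by move=> h p _ _ IHp Hg; rewrite rename_first_order IHp.
- by move=> h p _ _ IHp Hg; rewrite rename_first_order IHp.
- by move=> h p _ _ IHp Hg; rewrite rename_first_order IHp.
Qed.

(** * Truth in the two syntaxes and the comparison of complexity classes *)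

Section Semantics.
Variables (M : Type) (E : M -> M -> Prop).
Hypotheses (ext : extensionality E) (fnd : foundation E) (pai : pairing E).

Lemma sat_rename (X : set (set M)) phi : forall f g v V,
  sat E X v V (rename f g phi) <->
  sat E X (fun n => v (f n)) (fun n => V (g n)) phi.
Proof.
elim: phi => //=.
- by move=> p IHp q IHq f g v V; split=> H /IHp /H /IHq.
- by move=> p IHp f g v V; split=> H a; have:= H a;
    rewrite IHp scons_up_ren.
- by move=> p IHp f g v V; split=> -[a H]; exists a; move: H;
    rewrite IHp scons_up_ren.
- by move=> p IHp f g v V; split=> H a Xa; have:= H a Xa;
    rewrite IHp scons_up_ren.
- by move=> p IHp f g v V; split=> -[a [Xa H]]; exists a; split=> //; move: H;
    rewrite IHp scons_up_ren.
Qed.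

Section Truth.
Variable X : set (set M).

Fixpoint ssat (v : nat -> M) (V : nat -> set M) (phi : sform) : Prop :=
  match phi with
  | SM => E (v 0) (v 1)
  | SC => V 0 (v 0)
  | SF => False
  | SI phi psi => ssat v V phi -> ssat v V psi
  | SA phi => forall a, ssat (scons a v) V phi
  | SCA phi => forall A, X A -> ssat v (scons A V) phi
  | Sw phi => ssat (swap_env v) V phi
  | W1 phi => ssat (fun n => v n.+1) V phi
  | W2 phi => ssat v (fun n => V n.+1) phi
  end.

Lemma ssat_neg v V phi : ssat v V (sneg phi) <-> ~ ssat v V phi.
Proof. by []. Qed.

Lemma ssat_iff v V phi psi :
  ssat v V (siff phi psi) <-> (ssat v V phi <-> ssat v V psi).
Proof.
rewrite /=; split=> [H|[H1 H2] H]; last exact: H H1 H2.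
by split=> Hp; apply: contrapT => Hq; apply: H => H1 H2; auto.
Qed.

Lemma ssat_comp v V phi : ssat v V (scomp phi) <->
  exists2 A, X A & forall a, A a <-> ssat (scons a v) V phi.
Proof.
rewrite /scomp ssat_neg; split=> [H|[A XA HA] H].
  apply: contrapT => H'; apply: H => A XA H.
  by apply: H'; exists A => // a; exact: (ssat_iff _ (scons A V) SC (W2 phi)).1 (H a).
by apply: (H A XA) => a; apply/(ssat_iff _ _ SC (W2 phi)); apply: HA.
Qed.

Lemma ssat_back phi : forall v V, sat E X v V (back phi) <-> ssat v V phi.
Proof.
elim: phi => //=.
- by move=> p IHp q IHq v V; rewrite IHp IHq.
- by move=> p IHp v V; split=> H a; apply/IHp.
- by move=> p IHp v V; split=> H a Xa; apply/IHp; apply: H.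
- move=> p IHp v V; rewrite sat_rename IHp /=.
  have -> // : (fun n => v (swap_ren n)) = swap_env v.
  by apply: funext => -[|[|n]].
- by move=> p IHp v V; rewrite sat_rename IHp.
- by move=> p IHp v V; rewrite sat_rename IHp.
Qed.

(** Foundation applied to the singleton of [x]. *)
Lemma mem_irrefl x : ~ E x x.
Proof.
move=> xx; have [p pP] := pai x x.
have [y [yp ypN]] : exists y, E y p /\ forall z, E z p -> ~ E z y.
  by apply: fnd; exists x; apply/pP; left.
have yx : y = x by case: ((pP y).1 yp).
by apply: (ypN x); [apply/pP; left | rewrite yx].
Qed.

(** A formula looks at finitely many variables. Hence the finite lists that code assignments inside
    the model can replace arbitrary external assignments. *)
Lemma ssat_local phi : exists N, forall v v' V V',
  (forall n, n < N -> v n = v' n) -> (forall n, n < N -> V n = V' n) ->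
  ssat v V phi <-> ssat v' V' phi.
Proof.
elim: phi => [| | |p [N1 H1] q [N2 H2]|p [N H]|p [N H]|p [N H]|p [N H]|p [N H]].
- by exists 2 => v v' V V' vv VV /=; rewrite !vv.
- by exists 1 => v v' V V' vv VV /=; rewrite vv // VV.
- by exists 0.
- exists (maxn N1 N2) => v v' V V' vv VV /=.
  have Hl n : n < N1 -> n < maxn N1 N2 by move=> ?; rewrite leq_max; apply/orP; left.
  have Hr n : n < N2 -> n < maxn N1 N2 by move=> ?; rewrite leq_max; apply/orP; right.
  by rewrite (H1 v v' V V') ?(H2 v v' V V'); auto.
- exists N => v v' V V' vv VV /=.
  have {}H a : ssat (scons a v) V p <-> ssat (scons a v') V' p.
    by apply: H => // -[//|n] Hn; apply: vv; apply: ltnW.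
  by split=> Ha a; apply/H.
- exists N => v v' V V' vv VV /=.
  have {}H B : ssat v (scons B V) p <-> ssat v' (scons B V') p.
    by apply: H => // -[//|n] Hn; apply: VV; apply: ltnW.
  by split=> HB B XB; apply/H; apply: HB.
- exists N.+2 => v v' V V' vv VV /=; apply: H => n Hn; last first.
    by apply: VV; rewrite (ltn_trans Hn) // ltnW.
  by case: n Hn => [|[|n]] Hn /=; apply: vv => //; exact: leqW (leqW Hn).
- exists N.+1 => v v' V V' vv VV /=; apply: H => n Hn; first exact: vv.
  by apply: VV; apply: ltnW.
- exists N.+1 => v v' V V' vv VV /=; apply: H => n Hn; last exact: VV.
  by apply: vv; apply: ltnW.
Qed.

Lemma ssat_iter_drop j phi v V :
  ssat v V (iter j (fun psi => Sw (W1 psi)) phi) <->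
  ssat (scons (v 0) (fun n => v (j + n).+1)) V phi.
Proof.
elim: j v => [|j IH] v /=.
  by rewrite (_ : scons _ _ = v) //; apply: funext; case.
by rewrite IH.
Qed.

Lemma ssat_tr_mem i : forall j v V,
  ssat v V (tr_mem i j) <-> E (v i) (v j).
Proof.
elim: i => [|i IH] [|j] v V.
- by split=> //= /mem_irrefl.
- by rewrite /tr_mem ssat_iter_drop /= addn0.
- by rewrite /tr_mem ssat_iter_drop /= addn0.
- exact: IH.
Qed.

Lemma ssat_iter_W2 i v V phi :
  ssat v V (iter i W2 phi) <-> ssat v (fun n => V (i + n)) phi.
Proof. by elim: i V => [|i IH] V //=; rewrite IH. Qed.

Lemma ssat_iter_W1 i v V phi :
  ssat v V (iter i W1 phi) <-> ssat (fun n => v (i + n)) V phi.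
Proof. by elim: i v => [|i IH] v //=; rewrite IH. Qed.

Lemma ssat_tr phi : forall v V, ssat v V (tr phi) <-> sat E X v V phi.
Proof.
elim: phi.
- by move=> i j v V; apply: ssat_tr_mem.
- move=> i j v V; split=> [H|vv a].
    apply: ext => z.
    have := (ssat_iff _ _ (tr_mem 0 i.+1) (tr_mem 0 j.+1)).1 (H z).
    by rewrite !ssat_tr_mem.
  apply/(ssat_iff _ _ (tr_mem 0 i.+1) (tr_mem 0 j.+1)).
  by rewrite !ssat_tr_mem /= vv.
- by move=> i j v V; rewrite /= ssat_iter_W1 ssat_iter_W2 /= !addn0.
- move=> i j v V; split=> [H|/= VV a].
    rewrite /= predeqE => z.
    have := (ssat_iff _ _ (iter i W2 SC) (iter j W2 SC)).1 (H z).
    by rewrite !ssat_iter_W2 /= !addn0.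
  by apply/ssat_iff; rewrite !ssat_iter_W2 /= !addn0 VV.
- by [].
- by move=> p IHp q IHq v V; rewrite /= IHp IHq.
- by move=> p IHp v V; split=> H a; apply/IHp.
- move=> p IHp v V; rewrite [tr _]/= ssat_neg; split=> [H|[a /IHp Ha] H].
    by apply: contrapT => H'; apply: H => a; apply/ssat_neg => /IHp Ha;
      apply: H'; exists a.
  exact: H Ha.
- by move=> p IHp v V; split=> H a Xa; apply/IHp; apply: H.
- move=> p IHp v V; rewrite [tr _]/= ssat_neg; split=> [H|[a [Xa /IHp Ha]] H].
    by apply: contrapT => H'; apply: H => a Xa; apply/ssat_neg => /IHp Ha;
      apply: H'; exists a.
  exact: H Xa Ha.
Qed.

End Truth.

Definition sem_eq (phi : formula) (psi : sform) : Prop :=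
  forall X v V, ssat X v V psi <-> sat E X v V phi.

Definition sem_neg (phi : formula) (psi : sform) : Prop :=
  forall X v V, ssat X v V psi <-> ~ sat E X v V phi.

Lemma Pi1_inv k phi : Pi1 k.+1 phi ->
  exists n psi, Sigma1 k psi /\ phi = iter n.+1 ClassAll psi.
Proof. by move=> H; inversion H as [|k' n psi Hpsi]; exists n, psi. Qed.

Lemma Sigma1_inv k phi : Sigma1 k.+1 phi ->
  exists n psi, Pi1 k psi /\ phi = iter n.+1 ClassEx psi.
Proof. by move=> H; inversion H as [|k' n psi Hpsi]; exists n, psi. Qed.

Lemma Pi1_0_inv phi : Pi1 0 phi -> first_order phi.
Proof. by move=> H; inversion H. Qed.

Lemma Sigma1_0_inv phi : Sigma1 0 phi -> first_order phi.
Proof. by move=> H; inversion H. Qed.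

(** Grades only know universal class quantifiers, so a Sigma formula is represented through its
    negation and both halves are proved together. [SCA (sneg psi)] opens a new block, and [SCA psi']
    lengthens the current one. *)
Lemma graded_of_Pi1 k :
  (forall phi, Pi1 k phi -> exists2 psi, graded k.+1 psi & sem_eq phi psi) /\
  (forall phi, Sigma1 k phi -> exists2 psi, graded k.+1 psi & sem_neg phi psi).
Proof.
elim: k => [|k [IHP IHS]]; split=> phi.
- move=> /Pi1_0_inv Hphi; exists (tr phi); first exact: graded_tr.
  by move=> X v V; apply: ssat_tr.
- move=> /Sigma1_0_inv Hphi; exists (sneg (tr phi)).
    by constructor => //; [exact: graded_tr | constructor].
  by move=> X v V; rewrite ssat_neg ssat_tr.
- move=> /Pi1_inv[n [phi0 [/IHS[psi Hpsi Heq] ->]]] {phi}.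
  elim: n => [|n [psi' Hpsi' Heq']].
    exists (SCA (sneg psi)); first by constructor.
    move=> X v V /=; split=> H A XA.
      by apply: contrapT => /Heq; apply: H.
    by move=> /Heq; apply; apply: H.
  exists (SCA psi'); first by constructor.
  by move=> X v V; rewrite iterS; split=> H A XA; apply/Heq'; exact: (H A XA).
- move=> /Sigma1_inv[n [phi0 [/IHP[psi Hpsi Heq] ->]]] {phi}.
  elim: n => [|n [psi' Hpsi' Heq']].
    exists (SCA (sneg psi)); first by constructor.
    move=> X v V /=; split=> [H [A [XA /Heq HA]]|H A XA HA].
      exact: H HA.
    by apply: H; exists A; split=> //; apply/Heq.
  exists (SCA psi'); first by constructor.
  move=> X v V; rewrite iterS; split=> [H [A [XA HA]]|H A XA].
    by case: ((Heq' _ _ _).1 (H A XA)).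
  by apply/Heq' => HA; apply: H; exists A.
Qed.

Lemma Pi1_of_graded k psi : graded k.+1 psi ->
  (exists2 phi, Pi1 k phi & sem_eq phi psi) /\
  (exists2 phi, Sigma1 k phi & sem_neg phi psi).
Proof.
have base phi : graded 1 phi -> 
  (exists2 phi', Pi1 0 phi' & sem_eq phi' phi) /\
  (exists2 phi', Sigma1 0 phi' & sem_neg phi' phi).
  move=> /back_first_order Hphi; split.
    by exists (back phi); [constructor | move=> X v V; rewrite ssat_back].
  exists (Imp (back phi) False_); first by constructor; rewrite /= Hphi.
  by move=> X v V; rewrite /= ssat_back; split=> [H /(_ H)|/contrapT].
elim: k psi => // k IH psi H.
(* The grade becomes a variable tied by an equation, so that the induction on the derivation can
   follow [Gr_more], where the grade does not change. *)
have [g gk] : exists g, g = k.+2 by exists k.+2.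
rewrite -gk in H; elim: H gk; try by move=> [|[|?]] //.
- by [].
- move=> h phi Hphi _ [hk]; subst h.
  have [[phi' P1 E1] [phi'' S2 E2]] := IH _ Hphi; split.
    exists (ClassAll phi''); first exact: (@Pi1_S k 0).
    move=> X v V /=; split=> H A XA.
      by apply: contrapT => /E2; apply: H.
    by move=> /E2; apply; apply: H.
  exists (ClassEx phi'); first exact: (@Sigma1_S k 0).
  move=> X v V /=; split=> [H [A [XA /E1 HA]]|H A XA HA].
    exact: H HA.
  by apply: H; exists A; split=> //; apply/E1.
- move=> h phi _ IHh hk; have [[phi' P1 E1] [phi'' S2 E2]] := IHh hk; split.
    exists (ClassAll phi').
      by have [n [p [Hp ->]]] := Pi1_inv P1; apply: (@Pi1_S k n.+1).
    by move=> X v V /=; split=> H A XA; apply/E1; apply: H.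
  exists (ClassEx phi'').
    by have [n [p [Hp ->]]] := Sigma1_inv S2; apply: (@Sigma1_S k n.+1).
  move=> X v V /=; split=> [H [A [XA HA]]|H A XA].
    by case: ((E2 _ _ _).1 (H A XA)).
  by apply/E2 => HA; apply: H; exists A.
Qed.

(** Dummy class quantifiers are put in front, with the class indices shifted past them. They are
    harmless only if there is some class to quantify over, whence [X !=set0]. *)
Lemma pad_first_order k : forall phi, first_order phi ->
  (exists2 psi, Pi1 k psi & forall X v V, X !=set0 ->
     sat E X v V psi <-> sat E X v V phi) /\
  (exists2 psi, Sigma1 k psi & forall X v V, X !=set0 ->
     sat E X v V psi <-> sat E X v V phi).
Proof.
elim: k => [|k IH] phi Hphi.
  by split; exists phi => //; constructor.
have Hren : first_order (rename id succn phi) by rewrite rename_first_order.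
have [[psi P1 E1] [psi' S2 E2]] := IH _ Hren; split.
  exists (ClassAll psi'); first exact: (@Pi1_S k 0).
  move=> X v V [A XA] /=; split=> [H|H B XB].
    by have := H A XA; rewrite E2 ?sat_rename //; exists A.
  by rewrite E2 ?sat_rename //; exists A.
exists (ClassEx psi); first exact: (@Sigma1_S k 0).
move=> X v V [A XA] /=; split=> [[B [XB]]|H].
  by rewrite E1 ?sat_rename //; exists A.
by exists A; split=> //; rewrite E1 ?sat_rename //; exists A.
Qed.

End Semantics.

(** * Definability *)

Section Definability.
Variables (M : Type) (E : M -> M -> Prop).

(** A semantic stand-in for formulas: one formula has to work for every [X] and all assignments, and
    the flag [fo] demands that it be first-order. *)
Definition definable (fo : bool)
    (P : set (set M) -> (nat -> M) -> (nat -> set M) -> Prop) : Prop :=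
  exists2 phi, fo -> first_order phi & forall X v V, sat E X v V phi <-> P X v V.

Definition definable_term (t : (nat -> M) -> M) : Prop :=
  definable true (fun X v V => v 0 = t (fun n => v n.+1)).

Lemma definable_ext fo P Q :
  (forall X v V, P X v V <-> Q X v V) -> definable fo P -> definable fo Q.
Proof. by move=> PQ [phi H1 H2]; exists phi => // X v V; rewrite H2. Qed.

Lemma definable_weak fo P : definable true P -> definable fo P.
Proof. by move=> [phi H1 H2]; exists phi => // _; apply: H1. Qed.

Lemma definable_rename f g fo P : definable fo P ->
  definable fo (fun X v V => P X (fun n => v (f n)) (fun n => V (g n))).
Proof.
move=> [phi H1 H2]; exists (rename f g phi).
  by rewrite rename_first_order.
by move=> X v V; rewrite sat_rename.
Qed.

Lemma definable_False fo : definable fo (fun X v V => False).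
Proof. by exists False_. Qed.

Lemma definable_imp fo P Q : definable fo P -> definable fo Q ->
  definable fo (fun X v V => P X v V -> Q X v V).
Proof.
move=> [p P1 P2] [q Q1 Q2]; exists (Imp p q).
  by move=> Hfo; rewrite /= P1 // Q1.
by move=> X v V; rewrite /= P2 Q2.
Qed.

Lemma definable_not fo P : definable fo P ->
  definable fo (fun X v V => ~ P X v V).
Proof. by move=> HP; apply: definable_imp => //; apply: definable_False. Qed.

Lemma definable_and fo P Q : definable fo P -> definable fo Q ->
  definable fo (fun X v V => P X v V /\ Q X v V).
Proof.
move=> HP HQ; have := definable_not (definable_imp HP (definable_not HQ)).
apply: definable_ext => X v V; split=> [H|[p q] H]; last exact: H.
by split; apply: contrapT => H'; apply: H => // _ q.
Qed.

Lemma definable_or fo P Q : definable fo P -> definable fo Q ->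
  definable fo (fun X v V => P X v V \/ Q X v V).
Proof.
move=> HP HQ; have := definable_imp (definable_not HP) HQ.
apply: definable_ext => X v V; split=> [H|[]//].
by case: (pselect (P X v V)) => [|/H]; [left | right].
Qed.

Lemma definable_iff fo P Q : definable fo P -> definable fo Q ->
  definable fo (fun X v V => P X v V <-> Q X v V).
Proof. by move=> HP HQ; apply: definable_and; apply: definable_imp. Qed.

Lemma definable_and3 fo P Q R :
  definable fo P -> definable fo Q -> definable fo R ->
  definable fo (fun X v V => [/\ P X v V, Q X v V & R X v V]).
Proof.
move=> HP HQ HR; have := definable_and HP (definable_and HQ HR).
by apply: definable_ext => X v V; split=> [[? []]|[]].
Qed.

Lemma definable_and5 fo P Q R S T :
  definable fo P -> definable fo Q -> definable fo R -> definable fo S ->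
  definable fo T -> definable fo (fun X v V =>
    [/\ P X v V, Q X v V, R X v V, S X v V & T X v V]).
Proof.
move=> HP HQ HR HS HT.
have := definable_and HP (definable_and HQ (definable_and3 HR HS HT)).
by apply: definable_ext => X v V; split=> [[? [? []]]|[]].
Qed.

Lemma definable_or3 fo P Q R :
  definable fo P -> definable fo Q -> definable fo R ->
  definable fo (fun X v V => [\/ P X v V, Q X v V | R X v V]).
Proof.
move=> HP HQ HR; have := definable_or HP (definable_or HQ HR).
apply: definable_ext => X v V; split=> [[|[]]|[]]; by do ?[by constructor
  | by move=> ?; left | by move=> ?; right; left | by move=> ?; right; right].
Qed.

Lemma definable_all fo P :
  definable fo (fun X v V => P (v 0) X (fun n => v n.+1) V) ->
  definable fo (fun X v V => forall a, P a X v V).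
Proof.
move=> [phi H1 H2]; exists (All phi) => // X v V; split=> H a.
  exact: (H2 X (scons a v) V).1 (H a).
exact: (H2 X (scons a v) V).2 (H a).
Qed.

Lemma definable_ex fo P :
  definable fo (fun X v V => P (v 0) X (fun n => v n.+1) V) ->
  definable fo (fun X v V => exists a, P a X v V).
Proof.
move=> [phi H1 H2]; exists (Ex phi) => // X v V; split=> -[a H]; exists a.
  exact: (H2 X (scons a v) V).1 H.
exact: (H2 X (scons a v) V).2 H.
Qed.

Lemma definable_class_all P :
  definable false (fun X v V => P (V 0) X v (fun n => V n.+1)) ->
  definable false (fun X v V => forall A : set M, X A -> P A X v V).
Proof.
move=> [phi H1 H2]; exists (ClassAll phi) => // X v V; split=> H A XA.
  exact: (H2 X v (scons A V)).1 (H A XA).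
exact: (H2 X v (scons A V)).2 (H A XA).
Qed.

Lemma definable_class_ex P :
  definable false (fun X v V => P (V 0) X v (fun n => V n.+1)) ->
  definable false (fun X v V => exists A : set M, X A /\ P A X v V).
Proof.
move=> [phi H1 H2]; exists (ClassEx phi) => // X v V.
split=> -[A [XA H]]; exists A; split=> //.
  exact: (H2 X v (scons A V)).1 H.
exact: (H2 X v (scons A V)).2 H.
Qed.

Lemma definable_var i : definable_term (fun v => v i).
Proof. by exists (Eq 0 i.+1). Qed.

Lemma definable_subst fo P t : definable_term t ->
  definable fo (fun X v V => P (v 0) X (fun n => v n.+1) V) ->
  definable fo (fun X v V => P (t v) X v V).
Proof.
move=> Ht HP; have := definable_ex (P := fun a X v V => a = t v /\ P a X v V)
  (definable_and (definable_weak fo Ht) HP).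
apply: definable_ext => X v V; split=> [[a [/= -> ]]//|H].
by exists (t v).
Qed.

Lemma definable_term_ren f t : definable_term t ->
  definable_term (fun v => t (fun n => v (f n))).
Proof.
move=> Ht; have := definable_rename (up_ren f) id Ht.
by apply: definable_ext => X v V.
Qed.

Lemma definable_app2 fo (P : M -> M -> Prop) t u :
  definable true (fun X v V => P (v 0) (v 1)) ->
  definable_term t -> definable_term u ->
  definable fo (fun X v V => P (t v) (u v)).
Proof.
move=> HP Ht Hu; apply: definable_weak.
apply: (definable_subst (P := fun a X v V => P a (u v)) Ht).
apply: (definable_subst (P := fun b X v V => P (v 0) b)
         (definable_term_ren succn Hu)).
have := definable_rename (fun n => if n is 0 then 1 else 0) id HP.
by apply: definable_ext.
Qed.

Lemma definable_mem fo t u : definable_term t -> definable_term u ->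
  definable fo (fun X v V => E (t v) (u v)).
Proof. by apply: definable_app2; exists (Mem 0 1). Qed.

Lemma definable_eq fo t u : definable_term t -> definable_term u ->
  definable fo (fun X v V => t v = u v).
Proof. by apply: definable_app2; exists (Eq 0 1). Qed.

Lemma definable_class fo i t : definable_term t ->
  definable fo (fun X v V => V i (t v)).
Proof.
move=> Ht; apply: definable_weak.
apply: (definable_subst (P := fun a X v V => V i a) Ht).
by exists (ClassMem 0 i).
Qed.

Lemma definable_op1 (F : M -> M) t :
  definable true (fun X v V => v 0 = F (v 1)) ->
  definable_term t -> definable_term (fun v => F (t v)).
Proof.
move=> HF /(definable_term_ren succn) Ht.
exact: (definable_app2 _ (P := fun a b => a = F b) HF (definable_var 0) Ht).
Qed.

Lemma definable_op2 (F : M -> M -> M) t u :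
  definable true (fun X v V => v 0 = F (v 1) (v 2)) ->
  definable_term t -> definable_term u ->
  definable_term (fun v => F (t v) (u v)).
Proof.
move=> HF Ht Hu.
apply: (definable_subst (P := fun a X v V => v 0 = F a (u (fun n => v n.+1)))
         (definable_term_ren succn Ht)).
apply: (definable_subst (P := fun a X v V => v 1 = F (v 0) a)
         (definable_term_ren (fun n => n.+2) Hu)).
have := definable_rename
  (fun n => match n with 0 => 2 | 1 => 1 | _ => 0 end) id HF.
by apply: definable_ext.
Qed.

End Definability.

Ltac definability_term := cbv beta; first
  [ solve [auto with definable_db]
  | lazymatch goal with
    | |- definable_term _ (fun v => v ?i) => exact: definable_var
    end
  | apply: definable_op1; [solve [auto with definable_db] | definability_term]
  | apply: definable_op2;
      [solve [auto with definable_db] | definability_term | definability_term] ].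

(** The patterns overlap, so their order matters: class quantifiers are tried before set
    quantifiers, implication before universal quantification, and membership, whose pattern fits any
    binary application, comes last. *)
Ltac definability := cbv beta; lazymatch goal with
  | |- definable _ _ (fun X v V => False) => apply: definable_False
  | |- definable _ _ (fun X v V => ~ @?P X v V) =>
      apply: definable_not; definability
  | |- definable _ _ (fun X v V => forall A : set _, X A -> @?P X v V A) =>
      apply: definable_class_all; definability
  | |- definable _ _ (fun X v V => exists A : set _, X A /\ @?P X v V A) =>
      apply: definable_class_ex; definability
  | |- definable _ _ (fun X v V => @?P X v V -> @?Q X v V) =>
      apply: definable_imp; definability
  | |- definable _ _ (fun X v V => @?P X v V /\ @?Q X v V) =>
      apply: definable_and; definability
  | |- definable _ _ (fun X v V => @?P X v V \/ @?Q X v V) =>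
      apply: definable_or; definability
  | |- definable _ _ (fun X v V => @?P X v V <-> @?Q X v V) =>
      apply: definable_iff; definability
  | |- definable _ _ (fun X v V => [/\ _, _ & _]) =>
      apply: definable_and3; definability
  | |- definable _ _ (fun X v V => [/\ _, _, _, _ & _]) =>
      apply: definable_and5; definability
  | |- definable _ _ (fun X v V => [\/ _, _ | _]) =>
      apply: definable_or3; definability
  | |- definable _ _ (fun X v V => forall a, @?P X v V a) =>
      apply: definable_all; definability
  | |- definable _ _ (fun X v V => exists a, @?P X v V a) =>
      apply: definable_ex; definability
  | |- definable _ _ (fun X v V => @?t v = @?u v) =>
      apply: definable_eq; definability_term
  | |- definable _ _ (fun X v V => V ?i (@?t v)) =>
      apply: definable_class; definability_term
  | |- definable _ _ (fun X v V => _ (@?t v) (@?u v)) =>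
      apply: definable_mem; definability_term
  end.

Create HintDb definable_db discriminated.
Hint Constants Opaque : definable_db.
Hint Variables Opaque : definable_db.

(** * Class Replacement and Global Choice as single formulas *)

Section GBCsentences.
Variables (M : Type) (E : M -> M -> Prop).

Lemma definable_class_replacement :
  definable E false (fun X v V => class_replacement E X).
Proof.
rewrite /class_replacement /class_function /class_rel /is_pair /is_upair.
definability.
Qed.

Lemma definable_global_choice :
  definable E false (fun X v V => global_choice E X).
Proof.
(* The conjunction is regrouped so that [X F] stands as the guard of the class quantifier. *)
apply: (@definable_ext _ _ _ (fun X v V => exists F, X F /\
  [/\ class_function E F,
    forall x, (exists y, class_rel E F x y) <-> is_ordinal E x &
    (forall x x' y, class_rel E F x y -> class_rel E F x' y -> x = x') /\
    forall y, exists x, class_rel E F x y])).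
  by move=> X _ _; split=> -[F]; [case=> ? [? ? []] | case]; exists F.
rewrite /class_function /is_ordinal /class_rel /is_pair /is_upair.
rewrite /nonempty_set /subset_of.
definability.
Qed.

End GBCsentences.

(** * The consistency game *)

Section Game.
Variables (M : Type) (E : M -> M -> Prop).
Hypothesis zfc : ZFC E.

Let ext : extensionality E := ZFC_extensionality zfc.
Let irrefl x : ~ E x x.
Proof. exact: mem_irrefl (ZFC_foundation zfc) (ZFC_pairing zfc) x. Qed.

Fact emp_subproof : exists e, forall z, ~ E z e.
Proof.
have [w [[e [_ eN]] _]] := ZFC_infinity zfc.
by exists e => z ze; apply: eN; exists z.
Qed.

Definition emp : M := projT1 (cid emp_subproof).

Lemma mem_emp z : ~ E z emp.
Proof. exact: (projT2 (cid emp_subproof)). Qed.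

Lemma empP x : x = emp <-> forall z, ~ E z x.
Proof.
split=> [->|H]; first exact: mem_emp.
by apply: ext => z; split=> [/H|/mem_emp].
Qed.

Definition upair (x y : M) : M := projT1 (cid (ZFC_pairing zfc x y)).

Lemma mem_upair x y z : E z (upair x y) <-> z = x \/ z = y.
Proof. exact: (projT2 (cid (ZFC_pairing zfc x y))). Qed.

Lemma is_upairP p x y : is_upair E p x y <-> p = upair x y.
Proof.
split=> [H|-> z]; last exact: mem_upair.
by apply: ext => z; rewrite H mem_upair.
Qed.

Lemma upair_inj x y u v : upair x y = upair u v ->
  x = u /\ y = v \/ x = v /\ y = u.
Proof.
move=> H.
have Hm z : (z = x \/ z = y) <-> (z = u \/ z = v).
  by rewrite -!mem_upair H.
have := (Hm x).1 (or_introl erefl); have := (Hm y).1 (or_intror erefl).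
have := (Hm u).2 (or_introl erefl); have := (Hm v).2 (or_intror erefl).
by move=> [?|?] [?|?] [?|?] [?|?]; subst; tauto.
Qed.

Definition pr (x y : M) : M := upair (upair x x) (upair x y).

Lemma is_pairP p x y : is_pair E p x y <-> p = pr x y.
Proof.
split=> [H|-> z]; last by rewrite mem_upair !is_upairP.
by apply: ext => z; rewrite H mem_upair !is_upairP.
Qed.

Lemma pr_inj a b c d : pr a b = pr c d -> a = c /\ b = d.
Proof.
by move=> /upair_inj[] [/upair_inj[]] [? ?] /upair_inj[] [? ?]; subst.
Qed.

Lemma pr_neq_emp a b : pr a b <> emp.
Proof. by move=> /empP /(_ (upair a a)); apply; apply/mem_upair; left. Qed.

Fact fst_subproof x :
  exists a, (exists b, x = pr a b) \/ (forall a b, x <> pr a b) /\ a = emp.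
Proof.
have [[a [b ->]]|H] := pselect (exists a b, x = pr a b).
  by exists a; left; exists b.
by exists emp; right; split=> // a b xab; apply: H; exists a, b.
Qed.

(** The projections are total, with default value [emp]; this makes them definable operations and
    makes [emp] a list all of whose entries are [emp]. *)
Definition pfst (x : M) : M := projT1 (cid (fst_subproof x)).

Fact snd_subproof x :
  exists b, (exists a, x = pr a b) \/ (forall a b, x <> pr a b) /\ b = emp.
Proof.
have [[a [b ->]]|H] := pselect (exists a b, x = pr a b).
  by exists b; left; exists a.
by exists emp; right; split=> // a b xab; apply: H; exists a, b.
Qed.

Definition psnd (x : M) : M := projT1 (cid (snd_subproof x)).

Lemma pfstP x a : a = pfst x <->
  (exists b, x = pr a b) \/ (forall a b, x <> pr a b) /\ a = emp.
Proof.
rewrite /pfst; case: cid => c /= Hc; split=> [-> //|].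
case: Hc => [[b ->]|[H ->]] [[b' ]|[H' ->]] //.
- by move=> /pr_inj[].
- by case: (H' _ _ erefl).
- by move=> /H.
Qed.

Lemma psndP x b : b = psnd x <->
  (exists a, x = pr a b) \/ (forall a b, x <> pr a b) /\ b = emp.
Proof.
rewrite /psnd; case: cid => c /= Hc; split=> [-> //|].
case: Hc => [[a ->]|[H ->]] [[a' ]|[H' ->]] //.
- by move=> /pr_inj[].
- by case: (H' _ _ erefl).
- by move=> /H.
Qed.

Lemma pfst_pr a b : pfst (pr a b) = a.
Proof. by apply/esym/pfstP; left; exists b. Qed.

Lemma psnd_pr a b : psnd (pr a b) = b.
Proof. by apply/esym/psndP; left; exists a. Qed.

Lemma pfst_emp : pfst emp = emp.
Proof. by apply/esym/pfstP; right; split=> // a b /esym/pr_neq_emp. Qed.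

Lemma psnd_emp : psnd emp = emp.
Proof. by apply/esym/psndP; right; split=> // a b /esym/pr_neq_emp. Qed.

Fact adj_subproof s x : exists t, forall z, E z t <-> E z s \/ z = x.
Proof.
have [u uP] := ZFC_union zfc (upair s (upair x x)).
exists u => z; rewrite uP; split=> [[y []]|[zs| ->]].
- by move=> /mem_upair[->|->] H; [left | right; case/mem_upair: H].
- by exists s; split=> //; apply/mem_upair; left.
- by exists (upair x x); split; apply/mem_upair; [right | left].
Qed.

Definition adj (s x : M) : M := projT1 (cid (adj_subproof s x)).

Lemma mem_adj s x z : E z (adj s x) <-> E z s \/ z = x.
Proof. exact: (projT2 (cid (adj_subproof s x))). Qed.

Lemma sub_adj s x z : E z s -> E z (adj s x).
Proof. by move=> ?; apply/mem_adj; left. Qed.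

Lemma in_adj s x : E x (adj s x).
Proof. by apply/mem_adj; right. Qed.

Lemma adjP s x t : t = adj s x <-> forall z, E z t <-> E z s \/ z = x.
Proof.
split=> [-> z|H]; first exact: mem_adj.
by apply: ext => z; rewrite H mem_adj.
Qed.

(** The successor is [pr x x], so that numerals are told apart by injectivity of pairs alone; they
    serve as tags, truth values and grades. *)
Definition num (n : nat) : M := iter n (fun x => pr x x) emp.

Lemma num_inj i j : num i = num j -> i = j.
Proof.
elim: i j => [|i IH] [|j] //=; first by move=> /esym/pr_neq_emp.
  by move=> /pr_neq_emp.
by move=> /pr_inj[/IH ->].
Qed.

(* A coded assignment is a list [pr a0 (pr a1 ...)]; past the end of the list
   the junk value is [emp]. *)
Definition ev (e : M) (n : nat) : M := pfst (iter n psnd e).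

Lemma ev_pr a e : ev (pr a e) = scons a (ev e).
Proof.
by apply: funext => -[|n]; rewrite /ev ?iterSr /= (pfst_pr, psnd_pr).
Qed.

Lemma ev_snd e : ev (psnd e) = (fun n => ev e n.+1).
Proof. by apply: funext => n; rewrite /ev iterSr. Qed.

Lemma ev_emp n : ev emp n = emp.
Proof. by rewrite /ev; elim: n => [|n]; rewrite ?iterSr ?psnd_emp ?pfst_emp. Qed.

Definition swapc (e : M) : M :=
  pr (pfst (psnd e)) (pr (pfst e) (psnd (psnd e))).

Lemma ev_swapc e : ev (swapc e) = swap_env (ev e).
Proof. by rewrite /swapc !ev_pr !ev_snd. Qed.

Definition cSM := pr (num 0) emp.
Definition cSC := pr (num 1) emp.
Definition cSF := pr (num 2) emp.
Definition cSI x y := pr (num 3) (pr x y).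
Definition cSA x := pr (num 4) x.
Definition cSCA x := pr (num 5) x.
Definition cSw x := pr (num 6) x.
Definition cW1 x := pr (num 7) x.
Definition cW2 x := pr (num 8) x.
Definition cneg x := cSI x cSF.
Definition ciff x y := cneg (cSI (cSI x y) (cneg (cSI y x))).
Definition ccomp x := cneg (cSCA (cneg (cSA (ciff cSC (cW2 x))))).

Fixpoint code (phi : sform) : M :=
  match phi with
  | SM => cSM
  | SC => cSC
  | SF => cSF
  | SI phi psi => cSI (code phi) (code psi)
  | SA phi => cSA (code phi)
  | SCA phi => cSCA (code phi)
  | Sw phi => cSw (code phi)
  | W1 phi => cW1 (code phi)
  | W2 phi => cW2 (code phi)
  end.

(* The entries of a position: [x] codes a formula of grade [g]; the class
   assignment [f] only uses declared names; [j] is a declared class name; the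
   formula [x] has truth value [b] under the assignments [e] and [f]. *)
Definition iGr g x := pr (num 0) (pr g x).
Definition iEnv f := pr (num 1) f.
Definition iNm j := pr (num 2) j.
Definition iFt b x e f := pr (num 3) (pr b (pr x (pr e f))).

(** Otherwise the double union [w] of [s] would contain every set, itself included: [w] lies in
    [upair (num 2) w], which lies in [iNm w]. *)
Lemma fresh_name s : exists j, ~ E (iNm j) s.
Proof.
apply: contrapT => H.
have {}H j : E (iNm j) s by apply: contrapT => Hj; apply: H; exists j.
have [u uP] := ZFC_union zfc s; have [w wP] := ZFC_union zfc u.
apply: (@irrefl w); apply/wP; exists (upair (num 2) w); split.
  by apply/uP; exists (iNm w); split=> //; apply/mem_upair; right.
by apply/mem_upair; right.
Qed.

Lemma definable_emp : definable_term E (fun v => emp).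
Proof.
apply: (definable_ext (fun X v V => iff_sym (empP (v 0)))).
definability.
Qed.

Lemma definable_pr : definable E true (fun X v V => v 0 = pr (v 1) (v 2)).
Proof.
apply: (definable_ext (fun X v V => is_pairP (v 0) (v 1) (v 2))).
rewrite /is_pair /is_upair; definability.
Qed.

Local Hint Resolve definable_emp definable_pr : definable_db.

Lemma definable_pfst : definable E true (fun X v V => v 0 = pfst (v 1)).
Proof.
apply: (definable_ext (fun X v V => iff_sym (pfstP (v 1) (v 0)))).
definability.
Qed.

Lemma definable_psnd : definable E true (fun X v V => v 0 = psnd (v 1)).
Proof.
apply: (definable_ext (fun X v V => iff_sym (psndP (v 1) (v 0)))).
definability.
Qed.

Lemma definable_adj : definable E true (fun X v V => v 0 = adj (v 1) (v 2)).
Proof.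
apply: (definable_ext (fun X v V => iff_sym (adjP (v 1) (v 2) (v 0)))).
definability.
Qed.

Lemma definable_num n : definable_term E (fun v => num n).
Proof.
elim: n => [|n Hn]; first exact: definable_emp.
exact: (definable_op2 definable_pr Hn Hn).
Qed.

Local Hint Resolve definable_pfst definable_psnd definable_adj
  definable_num : definable_db.

Lemma definable_code phi : definable_term E (fun v => code phi).
Proof.
elim: phi => [| | |p IHp q IHq|p IHp|p IHp|p IHp|p IHp|p IHp] /=;
  rewrite /cSM /cSC /cSF /cSI /cSA /cSCA /cSw /cW1 /cW2; definability_term.
Qed.

Variables (kappa : nat) (ax : sform).

Lemma definable_ax : definable_term E (fun v => code ax).
Proof. exact: definable_code. Qed.

Local Hint Resolve definable_ax : definable_db.

(** Only atomic formulas are tested. Two class membership entries conflict as soon as the first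
    items of their assignments agree, whatever the tails are. *)
Definition clash (y1 y2 : M) : Prop :=
  exists e f e' f',
  (y1 = iFt (num 1) cSC e f /\ y2 = iFt (num 0) cSC e' f' /\
     pfst e = pfst e' /\ pfst f = pfst f') \/
  (y1 = iFt (num 1) cSM e f /\ ~ E (pfst e) (pfst (psnd e))) \/
  (y1 = iFt (num 0) cSM e f /\ E (pfst e) (pfst (psnd e))) \/
  y1 = iFt (num 1) cSF e f.

(** The constructors of [graded], one step at a time on codes; [pr h h] is the successor of the
    grade [h]. *)
Definition rule_grade (y1 y2 g x : M) : Prop :=
  ((g = num 0 \/ g = num 1) /\
    ((x = cSM \/ x = cSC \/ x = cSF) \/
     exists u, y1 = iGr g u /\
       (x = cSA u \/ x = cSw u \/ x = cW1 u \/ x = cW2 u \/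
        exists w, y2 = iGr g w /\ x = cSI u w))) \/
  (g = num 0 /\ exists u, y1 = iGr g u /\ x = cSCA u) \/
  (exists h u, h <> num 0 /\ g = pr h h /\ y1 = iGr h u /\ x = cSCA (cneg u)) \/
  (g <> num 0 /\ g <> num 1 /\ exists u, y1 = iGr g u /\ x = cSCA u).

(** Closure conditions of a Hintikka set that involve no choice. The theory enters here: the axiom
    [ax], and comprehension for each formula of grade [kappa] with declared parameters. The last
    clause declares the leading name of the class assignment of a truth entry. *)
Definition rule (y1 y2 p : M) : Prop :=
  (exists g x, rule_grade y1 y2 g x /\ p = iGr g x) \/
  (exists j f, y1 = iNm j /\ y2 = iEnv f /\ p = iEnv (pr j f)) \/
  (y1 = iEnv emp /\ p = iFt (num 1) (code ax) emp emp) \/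
  (exists x e f, y1 = iGr (num kappa) x /\ y2 = iEnv f /\
     p = iFt (num 1) (ccomp x) e f) \/
  (exists x y e f, y1 = iFt (num 0) (cSI x y) e f /\
     (p = iFt (num 1) x e f \/ p = iFt (num 0) y e f)) \/
  (exists x e f a, y1 = iFt (num 1) (cSA x) e f /\
     p = iFt (num 1) x (pr a e) f) \/
  (exists x e f j, y1 = iFt (num 1) (cSCA x) e f /\ y2 = iNm j /\
     p = iFt (num 1) x e (pr j f)) \/
  (exists b x e f, y1 = iFt b (cSw x) e f /\ p = iFt b x (swapc e) f) \/
  (exists b x e f, y1 = iFt b (cW1 x) e f /\ p = iFt b x (psnd e) f) \/
  (exists b x e f, y1 = iFt b (cW2 x) e f /\ p = iFt b x e (psnd f)) \/
  (exists b x e f, y1 = iFt b x e f /\ p = iNm (pfst f)).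

(** The conditions that involve a choice: a true implication, a counterexample to a false
    quantifier, and the decision whether the set [p] belongs to the class named [j]. *)
Definition choice_rule (y p z : M) : Prop :=
  (exists x w e f, y = iFt (num 1) (cSI x w) e f /\
     (z = iFt (num 0) x e f \/ z = iFt (num 1) w e f)) \/
  (exists x e f a, y = iFt (num 0) (cSA x) e f /\
     z = iFt (num 0) x (pr a e) f) \/
  (exists x e f j, y = iFt (num 0) (cSCA x) e f /\
     z = iFt (num 0) x e (pr j f)) \/
  (exists j, y = iNm j /\
     (z = iFt (num 1) cSC (pr p emp) (pr j emp) \/
      z = iFt (num 0) cSC (pr p emp) (pr j emp))).

(* A move in the consistency game at the position [s]: the challenge
   [(y1, y2, p)] asks for the consequence [p] of [y1] and [y2], and for some
   [z] with [choice_rule y1 p z]; the new position [s'] has to meet it. *)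
Definition move (y1 y2 p s s' : M) : Prop :=
  (forall z, E z s -> E z s') /\
  (forall z w, E z s' -> E w s' -> ~ clash z w) /\
  (E y1 s -> E y2 s ->
    (rule y1 y2 p -> E p s') /\
    ((exists z, choice_rule y1 p z) ->
      exists z, E z s' /\ choice_rule y1 p z)).

(** [R] is a simulation: any challenge to [t] can be turned into a challenge to [s] so that every
    answer at [s] yields an answer at [t], with the pair staying in [R]. *)
Definition postfixed (R : set M) : Prop :=
  forall s t, R (pr s t) -> forall y1 y2 p, exists z1 z2 r,
    forall s', move z1 z2 r s s' -> exists t', move y1 y2 p t t' /\ R (pr s' t').

Ltac move_definability :=
  rewrite /move /clash /rule /choice_rule /rule_grade /swapc /ccomp /ciff /cneg;
  rewrite /iGr /iFt /iEnv /iNm /cSI /cSA /cSCA /cSw /cW1 /cW2 /cSC /cSM /cSF;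
  definability.

(** A greatest fixed point taken in the metatheory: [L] ranges over all predicates on [M], not only
    over classes of the model. *)
Definition live (s : M) : Prop :=
  exists2 L : M -> Prop, L s & forall t, L t ->
    forall y1 y2 p, exists t', move y1 y2 p t t' /\ L t'.

Lemma live_move s y1 y2 p : live s ->
  exists s', move y1 y2 p s s' /\ live s'.
Proof.
move=> [L Ls HL]; have [s' [ss' Ls']] := HL s Ls y1 y2 p.
by exists s'; split=> //; exists L.
Qed.

Lemma move_sub y1 y2 p s t t' : (forall z, E z s -> E z t) ->
  move y1 y2 p t t' -> move y1 y2 p s t'.
Proof.
move=> st [tt' [cl H]]; split=> [z /st /tt' //|]; split=> // /st y1t /st y2t.
exact: H.
Qed.

Lemma live_sub s t : (forall z, E z s -> E z t) -> live t -> live s.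
Proof.
move=> st lt; exists (fun s => exists2 t, live t & forall z, E z s -> E z t).
  by exists t.
move=> {st lt t} s' [t lt st] y1 y2 p; have [t' [tt' lt']] := live_move y1 y2 p lt.
by exists t'; split; [apply: move_sub tt' | exists t'].
Qed.

Lemma live_clash s z w : live s -> E z s -> E w s -> ~ clash z w.
Proof.
move=> /(live_move emp emp emp)[s' [[ss' [cl _]] _]] /ss' zs' /ss' ws'.
exact: cl.
Qed.

Lemma live_choice s y p : live s -> E y s -> (exists z, choice_rule y p z) ->
  exists2 s', live s' & (forall z, E z s -> E z s') /\
    exists z, E z s' /\ choice_rule y p z.
Proof.
move=> /(live_move y y p)[s' [[ss' [_ H]] ls']] ys Hr.
by exists s' => //; split=> //; apply: (H ys ys).2.
Qed.

(** * The largest simulation and the diagonal class *)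

Section Comparison.
Variable X : set (set M).
Hypothesis X_fo : forall P, definable E true P ->
  forall v V, (forall n, X (V n)) -> X [set a | P X (scons a v) V].
Hypothesis X_pi : forall P, definable E true P ->
  forall v V, (forall n, X (V n)) ->
  X [set a | forall A, X A -> P X (scons a v) (scons A V)].
Hypothesis X_ne : X !=set0.

Definition simulates : set M :=
  [set x | exists R, X R /\ postfixed R /\ R x].

Lemma simulates_postfixed : postfixed simulates.
Proof.
move=> s t [R [XR [pR Rst]]] y1 y2 p.
have [z1 [z2 [r H]]] := pR _ _ Rst y1 y2 p; exists z1, z2, r => s' /H.
by move=> [t' [? ?]]; exists t'; split=> //; exists R.
Qed.

Lemma X_simulates : X simulates.
Proof.
have [A0 XA0] := X_ne.
(* The complement of [simulates] is Pi^1_1: every postfixed class omits the pair. Complementing once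
   more is first-order. *)
pose P (X : set (set M)) v (V : nat -> set M) := postfixed (V 0) -> ~ V 0 (v 0).
have HP : definable E true P.
  by rewrite /P /postfixed; move_definability.
have XN := X_pi HP (fun=> emp) (V := fun=> A0) (fun=> XA0).
have Hneg : definable E true (fun X v V => ~ V 0 (v 0)) by definability.
have := X_fo Hneg (fun=> emp) (V := fun=> _) (fun=> XN).
congr X; rewrite predeqE => x; split=> [H|[R [XR [pR Rx]]] H] /=.
  apply: contrapT => H'; apply: H => A XA pA /= Ax; apply: H'.
  by exists A.
exact: H XR pR Rx.
Qed.

(** Knaster-Tarski: the pairs one step above [simulates] form a class, by first-order comprehension
    from [simulates], and this class is again postfixed. *)
Lemma simulates_max s t :
  (forall y1 y2 p, exists z1 z2 r, forall s', move z1 z2 r s s' ->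
     exists t', move y1 y2 p t t' /\ simulates (pr s' t')) ->
  simulates (pr s t).
Proof.
move=> H.
pose P (X : set (set M)) v (V : nat -> set M) := exists s t, v 0 = pr s t /\
  forall y1 y2 p, exists z1 z2 r, forall s', move z1 z2 r s s' ->
     exists t', move y1 y2 p t t' /\ V 0 (pr s' t').
have HP : definable E true P.
  by rewrite /P; move_definability.
have XP := X_fo HP (fun=> emp) (V := fun=> _) (fun=> X_simulates).
eexists; split; [exact: XP | split; last by exists s, t].
move=> s1 t1 [_ [_ [/= /pr_inj[<- <-] H1]]] y1 y2 p.
have [z1 [z2 [r H2]]] := H1 y1 y2 p; exists z1, z2, r => s' /H2[t' [tt' Ut']].
by exists t'; split=> //; exists s', t'; split=> //; apply: simulates_postfixed.
Qed.

Lemma simulates_live s t : simulates (pr s t) -> live s -> live t.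
Proof.
move=> Ust ls; exists (fun t => exists2 s, live s & simulates (pr s t)).
  by exists s.
move=> {s t Ust ls} t [s ls Ust] y1 y2 p.
have [z1 [z2 [r H]]] := simulates_postfixed Ust y1 y2 p.
have [s' [/H[t' [tt' Ut']] ls']] := live_move z1 z2 r ls.
by exists t'; split=> //; exists s'.
Qed.

(** The positions that some live position fails to be simulated from are closed under play. If a
    challenge to [s] had no answer of this kind, every answer would be related to every live answer
    at [t], and maximality would give [simulates (pr s t)]. *)
Lemma not_simulates_live s t : ~ simulates (pr s t) -> live t -> live s.
Proof.
move=> Ust lt; exists (fun s => exists2 t, live t & ~ simulates (pr s t)).
  by exists t.
move=> {s t Ust lt} s [t lt Ust] z1 z2 r.
apply: contrapT => H; apply: Ust; apply: simulates_max => y1 y2 p.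
exists z1, z2, r => s' ss'; have [t' [tt' lt']] := live_move y1 y2 p lt.
exists t'; split=> //; apply: contrapT => Us't'; apply: H.
by exists s'; split=> //; exists t'.
Qed.

Definition fact (b : nat) (m i : M) : M :=
  iFt (num b) cSC (pr m emp) (pr i emp).

Definition diagonal : set M := [set c |
  ~ simulates (pr (adj (pfst c) (fact 0 c (psnd c)))
                  (adj (pfst c) (fact 1 c (psnd c))))].

Lemma X_diagonal : X diagonal.
Proof.
have HP : definable E true (fun X v V => ~ V 0
    (pr (adj (pfst (v 0)) (fact 0 (v 0) (psnd (v 0))))
        (adj (pfst (v 0)) (fact 1 (v 0) (psnd (v 0)))))).
  by rewrite /fact /iFt /cSC; definability.
exact: (X_fo HP (fun=> emp) (V := fun=> _) (fun=> X_simulates)).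
Qed.

Lemma diagonalE s i : diagonal (pr s i) <->
  ~ simulates (pr (adj s (fact 0 (pr s i) i)) (adj s (fact 1 (pr s i) i))).
Proof. by rewrite /diagonal /= pfst_pr psnd_pr. Qed.

Lemma live_decide s m i : live s -> E (iNm i) s ->
  live (adj s (fact 0 m i)) \/ live (adj s (fact 1 m i)).
Proof.
move=> ls si.
have [|s' ls' [ss' [z [zs' Hz]]]] := @live_choice s (iNm i) m ls si.
  by exists (fact 1 m i); do 3 right; exists i; split=> //; left.
suff zE : z = fact 1 m i \/ z = fact 0 m i.
  case: zE => zE; subst z; [right | left];
    by apply: live_sub ls' => w /mem_adj[/ss'|->].
case: Hz => [[? [? [? [? []]]]]|[[? [? [? [? []]]]]|[[? [? [? [? []]]]]|]]].
- by move=> /pr_inj[/num_inj].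
- by move=> /pr_inj[/num_inj].
- by move=> /pr_inj[/num_inj].
- by move=> [j [/pr_inj[_ <-]]].
Qed.

(** The diagonal choice is [m = pr s i]. Some answer about [m] is live; if it is the correct one,
    the definition of [diagonal] says which of the two transfer lemmas carries liveness over to the
    wrong one. *)
Lemma diagonal_not_isolated s i : live s -> E (iNm i) s ->
  exists m, diagonal m /\ live (adj s (fact 0 m i)) \/
            ~ diagonal m /\ live (adj s (fact 1 m i)).
Proof.
move=> ls si; exists (pr s i).
have [D|nD] := pselect (diagonal (pr s i)); [left|right]; split=> //.
  have [//|l1] := live_decide (pr s i) ls si.
  by apply: not_simulates_live l1; apply/diagonalE.
have [l0|//] := live_decide (pr s i) ls si.
apply: simulates_live l0; apply: contrapT => H.
by apply: nD; apply/diagonalE.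
Qed.

End Comparison.

Ltac pair_inv := unfold iGr, iEnv, iNm, iFt, fact, cneg in *;
  unfold cSM, cSC, cSF, cSI, cSA, cSCA, cSw, cW1, cW2 in *;
  repeat match goal with
  | H : pr _ _ = pr _ _ |- _ =>
      let H1 := fresh in let H2 := fresh in
      move: H => /pr_inj[H1 H2]
  | H : num _ = num _ |- _ => move: H => /num_inj H
  end; subst; try discriminate.

Ltac fact_inv HF H Hv :=
  let beta := fresh "beta" in let psi := fresh "psi" in
  have [? [beta [psi [? ? Hv]]]] := HF _ _ _ _ H;
  destruct beta; destruct psi; simpl code in *; pair_inv.

(** * A realization provides a winning strategy *)

Section Strategy.
Variable X : set (set M).
Hypothesis X_ax : forall v V, (forall n, X (V n)) -> ssat E X v V ax.
Hypothesis X_comp : forall psi, graded kappa psi ->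
  forall v V, (forall n, X (V n)) -> X [set a | ssat E X (scons a v) V psi].

Definition value (I : M -> set M) (e f : M) (psi : sform) : Prop :=
  ssat E X (ev e) (fun n => I (ev f n)) psi.

(** The entries are true when names are read through [I], and the graded or evaluated formulas are
    codes of actual formulas, so no satisfaction of nonstandard codes is needed. [I] is total; its
    values at undeclared names are free to change. *)
Record sound (I : M -> set M) (s : M) : Prop := {
  sound_X : forall j, X (I j);
  sound_emp : E (iNm emp) s;
  sound_Gr : forall g x, E (iGr g x) s ->
    exists k psi, [/\ g = num k, x = code psi & graded k psi];
  sound_Env : forall f, E (iEnv f) s -> forall n, E (iNm (ev f n)) s;
  sound_Ft : forall b x e f, E (iFt b x e f) s ->
    (forall n, E (iNm (ev f n)) s) /\
    exists (beta : bool) psi,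
      [/\ b = num beta, x = code psi & value I e f psi <-> beta]
}.

Lemma sound_add_Gr I s k psi : sound I s -> graded k psi ->
  sound I (adj s (iGr (num k) (code psi))).
Proof.
move=> [IX H0 HG HE HF] gk; split=> //; first exact: sub_adj.
- move=> g x /mem_adj[/HG //|H]; exists k, psi; pair_inv; split=> //.
- move=> f /mem_adj[/HE H n|H]; [exact: sub_adj | pair_inv].
- move=> b x e f /mem_adj[/HF[H ?]|H]; last by pair_inv.
  by split=> // n; apply: sub_adj.
Qed.

Lemma sound_add_Nm I s j : sound I s -> sound I (adj s (iNm j)).
Proof.
move=> [IX H0 HG HE HF]; split=> //; first exact: sub_adj.
- by move=> g x /mem_adj[/HG //|H]; pair_inv.
- by move=> f /mem_adj[/HE H n|H]; [exact: sub_adj | pair_inv].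
- move=> b x e f /mem_adj[/HF[H ?]|H]; last by pair_inv.
  by split=> // n; apply: sub_adj.
Qed.

Lemma sound_add_Env I s f : sound I s -> (forall n, E (iNm (ev f n)) s) ->
  sound I (adj s (iEnv f)).
Proof.
move=> [IX H0 HG HE HF] Hf; split=> //; first exact: sub_adj.
- by move=> g x /mem_adj[/HG //|H]; pair_inv.
- move=> f' /mem_adj[/HE H n|H n]; first exact: sub_adj.
  by apply: sub_adj; pair_inv.
- move=> b x e f' /mem_adj[/HF[H ?]|H]; last by pair_inv.
  by split=> // n; apply: sub_adj.
Qed.

Lemma sound_add_Ft I s (beta : bool) psi e f : sound I s ->
  (forall n, E (iNm (ev f n)) s) -> (value I e f psi <-> beta) ->
  sound I (adj s (iFt (num beta) (code psi) e f)).
Proof.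
move=> [IX H0 HG HE HF] Hf Hv; split=> //; first exact: sub_adj.
- by move=> g x /mem_adj[/HG //|H]; pair_inv.
- by move=> f' /mem_adj[/HE H n|H]; [exact: sub_adj | pair_inv].
- move=> b x e' f' /mem_adj[/HF[H ?]|H].
    by split=> // n; apply: sub_adj.
  pair_inv; split=> [n|]; first exact: sub_adj.
  by exists beta, psi.
Qed.

Lemma sound_clash I s y1 y2 : sound I s -> E y1 s -> E y2 s -> ~ clash y1 y2.
Proof.
move=> [IX H0 HG HE HF] y1s y2s [e [f [e' [f' [[? [? [ee ff]]]|[[? H]|[[? H]|?]]]]]]];
  subst.
- fact_inv HF y1s Hv; fact_inv HF y2s Hv'.
  suff: value I e' f' SC by move=> /Hv'.
  by have := Hv.2 isT; rewrite /value /= /ev /= ee ff.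
- by fact_inv HF y1s Hv; apply: H; apply: Hv.2.
- by fact_inv HF y1s Hv; have := Hv.1 H.
- by fact_inv HF y1s Hv; apply: Hv.2.
Qed.

Lemma sound_rule_grade I s y1 y2 g x : sound I s -> E y1 s -> E y2 s ->
  rule_grade y1 y2 g x -> sound I (adj s (iGr g x)).
Proof.
move=> sI y1s y2s H.
suff [k [psi [-> -> ?]]] : exists k psi, [/\ g = num k, x = code psi & graded k psi].
  exact: sound_add_Gr.
have HG := sound_Gr sI.
case: H => [[gl [[|[|]] ->|[u [? H]]]]|[[? [u [? ->]]]|[[h [u [h0 [-> [? ->]]]]]|]]].
- by case: gl => ->; [exists 0, SM|exists 1, SM]; split=> //; constructor.
- by case: gl => ->; [exists 0, SC|exists 1, SC]; split=> //; constructor.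
- by case: gl => ->; [exists 0, SF|exists 1, SF]; split=> //; constructor.
- subst y1; have [k [psi [gk ? gr]]] := HG _ _ y1s; subst g u.
  have k1 : k <= 1 by case: gl => /num_inj ->.
  exists k; case: H => [->|[->|[->|[->|[w [? ->]]]]]].
  + by exists (SA psi); split=> //; constructor.
  + by exists (Sw psi); split=> //; constructor.
  + by exists (W1 psi); split=> //; constructor.
  + by exists (W2 psi); split=> //; constructor.
  + subst y2; have [k' [psi' [/num_inj ? -> gr']]] := HG _ _ y2s; subst k'.
    by exists (SI psi psi'); split=> //; constructor.
- subst g y1; have [k [psi [/num_inj <- -> gr]]] := HG _ _ y1s.
  by exists 0, (SCA psi); split=> //; constructor.
- subst y1; have [k [psi [? -> gr]]] := HG _ _ y1s; subst h.
  case: k => // k in h0 gr y1s *.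
  by exists k.+2, (SCA (sneg psi)); split=> //; constructor.
- move=> [g0 [g1 [u [? ->]]]]; subst y1.
  have [k [psi [? -> gr]]] := HG _ _ y1s; subst g.
  case: k => [|[|k]] // in g0 g1 gr y1s *.
  by exists k.+2, (SCA psi); split=> //; constructor.
Qed.

Lemma sound_rule I s y1 y2 p : sound I s -> E y1 s -> E y2 s ->
  rule y1 y2 p -> sound I (adj s p).
Proof.
move=> sI y1s y2s; have [IX H0 HG HE HF] := sI.
case=> [[g [x [H ->]]]|]; first exact: sound_rule_grade H.
case=> [[j [f [? [? ->]]]]|]; subst.
  apply: sound_add_Env => // n; rewrite ev_pr.
  by case: n => //= n; apply: HE.
case=> [[? ->]|]; subst.
  apply: (sound_add_Ft (beta := true)) => //; first exact: HE.
  by split=> // _; apply: X_ax.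
case=> [[x [e [f [? [? ->]]]]]|]; subst.
  have [k [psi [/num_inj ? -> gr]]] := HG _ _ y1s; subst k.
  apply: (sound_add_Ft (beta := true) (psi := scomp psi)) => //; first exact: HE.
  split=> // _; apply/ssat_comp.
  exists [set a | ssat E X (scons a (ev e)) (fun n => I (ev f n)) psi] => //.
  by apply: (X_comp gr) => n; apply: IX.
case=> [[x [y [e [f [? [->|->]]]]]]|]; subst.
- fact_inv HF y1s Hv.
  apply: (sound_add_Ft (beta := true)) => //.
  split=> // _; apply: contrapT => Hn; suff: false by [].
  by apply: Hv.1 => /Hn.
- fact_inv HF y1s Hv.
  apply: (sound_add_Ft (beta := false)) => //.
  by split=> // Hn; apply: Hv.1 => _.
case=> [[x [e [f [a [? ->]]]]]|]; subst.
  fact_inv HF y1s Hv.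
  apply: (sound_add_Ft (beta := true)) => //.
  by split=> // _; rewrite /value ev_pr; apply: Hv.2.
case=> [[x [e [f [j [? [? ->]]]]]]|]; subst.
  fact_inv HF y1s Hv.
  apply: (sound_add_Ft (beta := true)) => //.
    by move=> n; rewrite ev_pr; case: n.
  split=> // _; rewrite /value ev_pr scons_comp.
  exact: Hv.2.
case=> [[b [x [e [f [? ->]]]]]|]; subst.
  have [Hf [beta [psi [? ? Hv]]]] := HF _ _ _ _ y1s; subst b.
  destruct psi; simpl code in *; pair_inv.
  by apply: sound_add_Ft => //; rewrite /value ev_swapc.
case=> [[b [x [e [f [? ->]]]]]|]; subst.
  have [Hf [beta [psi [? ? Hv]]]] := HF _ _ _ _ y1s; subst b.
  destruct psi; simpl code in *; pair_inv.
  by apply: sound_add_Ft => //; rewrite /value ev_snd.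
case=> [[b [x [e [f [? ->]]]]]|]; subst.
  have [Hf [beta [psi [? ? Hv]]]] := HF _ _ _ _ y1s; subst b.
  destruct psi; simpl code in *; pair_inv.
  by apply: sound_add_Ft => // [n|]; rewrite ?/value ev_snd.
move=> [b [x [e [f [? ->]]]]]; exact: sound_add_Nm.
Qed.

Lemma sound_choice_rule I s y p : sound I s -> E y s ->
  (exists z, choice_rule y p z) ->
  exists I' s', [/\ sound I' s', forall z, E z s -> E z s' &
    exists z, E z s' /\ choice_rule y p z].
Proof.
move=> sI ys [z Hz]; have [IX H0 HG HE HF] := sI.
have step (b : bool) psi e f : (forall n, E (iNm (ev f n)) s) ->
    (value I e f psi <-> b) ->
    choice_rule y p (iFt (num b) (code psi) e f) ->
    exists I' s', [/\ sound I' s', forall z, E z s -> E z s' &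
      exists z, E z s' /\ choice_rule y p z].
  move=> Hf Hv Hr; exists I, (adj s (iFt (num b) (code psi) e f)); split.
  - exact: sound_add_Ft.
  - by move=> w; apply: sub_adj.
  - by exists (iFt (num b) (code psi) e f); split=> //; apply: in_adj.
case: Hz => [[x [w [e [f [? _]]]]]|]; subst.
  fact_inv HF ys Hv.
  have [Ht|Hn] := pselect (value I e f psi1).
    apply: (step true psi2 e f) => //.
      by split=> // _; apply: Hv.2.
    by left; exists (code psi1), (code psi2), e, f; split=> //; right.
  apply: (step false psi1 e f) => //.
  by left; exists (code psi1), (code psi2), e, f; split=> //; left.
case=> [[x [e [f [a0 [? _]]]]]|]; subst.
  fact_inv HF ys Hv.
  have [a Ha] : exists a, ~ value I (pr a e) f psi.
    apply: contrapT => Hn; suff: false by [].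
    apply: Hv.1 => a; apply: contrapT => Ha; apply: Hn; exists a.
    by rewrite /value ev_pr.
  apply: (step false psi (pr a e) f) => //.
  by right; left; exists (code psi), e, f, a.
case=> [[x [e [f [j0 [? _]]]]]|]; subst.
  fact_inv HF ys Hv.
  have [A XA HA] : exists2 A, X A &
      ~ ssat E X (ev e) (scons A (fun n => I (ev f n))) psi.
    apply: contrapT => Hn; suff: false by [].
    by apply: Hv.1 => A XA; apply: contrapT => HA; apply: Hn; exists A.
  have [j Hj] := fresh_name s.
  pose I' k := if pselect (k = j) then A else I k.
  have I'j : I' j = A by rewrite /I'; case: pselect.
  have I'ev g : (forall n, E (iNm (ev g n)) s) ->
      (fun n => I' (ev g n)) = (fun n => I (ev g n)).
    move=> Hg; apply: funext => n; rewrite /I'; case: pselect => // gj.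
    by case: Hj; rewrite -gj; apply: Hg.
  have sI' : sound I' s.
    split=> //.
    - by move=> k; rewrite /I'; case: pselect => _ //=; apply: IX.
    - move=> b x e' f' /HF[Hf' [beta [phi [? ? Hv']]]]; split=> //.
      by exists beta, phi; split=> //; rewrite /value I'ev.
  exists I', (adj (adj s (iNm j)) (iFt (num 0) (code psi) e (pr j f))); split.
  - apply: (sound_add_Ft (beta := false)) => //; first exact: sound_add_Nm.
      move=> n; rewrite ev_pr; case: n => [|n] /=; first exact: in_adj.
      exact: sub_adj.
    by split=> //; rewrite /value ev_pr scons_comp I'j I'ev.
  - by move=> w ws; do 2 apply: sub_adj.
  - eexists; split; first exact: in_adj.
    by right; right; left; exists (code psi), e, f, j.
move=> [j [? _]]; subst.
have Hf n : E (iNm (ev (pr j emp) n)) s.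
  by rewrite ev_pr; case: n => //= n; rewrite ev_emp.
have [H|H] := pselect (value I (pr p emp) (pr j emp) SC).
  apply: (step true SC (pr p emp) (pr j emp)) => //.
  by do 3 right; exists j; split=> //; left.
apply: (step false SC (pr p emp) (pr j emp)) => //.
by do 3 right; exists j; split=> //; right.
Qed.

(** Sound positions are closed under play: the consequence is added first, then the choice, possibly
    with a new interpretation of names. *)
Lemma sound_live I s : sound I s -> live s.
Proof.
move=> sI; exists (fun s => exists I, sound I s); first by exists I.
move=> {s I sI} s [I sI] y1 y2 p.
have [s1 [s1I ss1 Hs1]] : exists s1, [/\ sound I s1,
    forall z, E z s -> E z s1 & E y1 s -> E y2 s -> rule y1 y2 p -> E p s1].
  have [[y1s [y2s Hr]]|H] := pselect (E y1 s /\ E y2 s /\ rule y1 y2 p).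
    exists (adj s p); split; first exact: sound_rule Hr.
      by move=> z; apply: sub_adj.
    by move=> *; apply: in_adj.
  by exists s; split=> // y1s y2s Hr; case: H.
have [I' [s2 [s2I ss2 Hs2]]] : exists I' s2, [/\ sound I' s2,
    forall z, E z s1 -> E z s2 & E y1 s -> (exists z, choice_rule y1 p z) ->
      exists z, E z s2 /\ choice_rule y1 p z].
  have [[y1s Hr]|H] := pselect (E y1 s /\ exists z, choice_rule y1 p z).
    have [I' [s2 [? ? ?]]] := sound_choice_rule s1I (ss1 _ y1s) Hr.
    by exists I', s2; split.
  by exists I, s1; split=> // y1s Hr; case: H.
exists s2; split; last by exists I'.
split; first by move=> z /ss1 /ss2.
split; first by move=> z w zs ws; apply: sound_clash s2I zs ws.
by move=> y1s y2s; split=> [/Hs1 H|]; [apply/ss2/H | apply: Hs2].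
Qed.

Definition start : M := adj (adj emp (iNm emp)) (iEnv emp).

Lemma live_start : X !=set0 -> live start.
Proof.
move=> [A XA]; apply: (@sound_live (fun=> A)); apply: sound_add_Env.
  split=> //; first exact: in_adj.
  - by move=> g x /mem_adj[/mem_emp|H] //; pair_inv.
  - by move=> f /mem_adj[/mem_emp|H] //; pair_inv.
  - by move=> b x e f /mem_adj[/mem_emp|H] //; pair_inv.
by move=> n; rewrite ev_emp; apply: in_adj.
Qed.

End Strategy.

(** * A generic play avoiding [A] *)

Section Branch.
Variable A : set M.
Hypothesis M_countable : countable [set: M].
Hypothesis start_live : live start.
Hypothesis not_isolated : forall s i, live s -> E (iNm i) s ->
  exists m, A m /\ live (adj s (fact 0 m i)) \/
            ~ A m /\ live (adj s (fact 1 m i)).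

Definition step (q : M * M * M * M) (s s' : M) : Prop :=
  let: (y1, y2, p, i) := q in
  [/\ live s', forall z, E z s -> E z s',
    E y1 s -> E y2 s -> rule y1 y2 p -> E p s',
    E y1 s -> (exists z, choice_rule y1 p z) ->
      exists z, E z s' /\ choice_rule y1 p z &
    E (iNm i) s -> exists m, A m /\ E (fact 0 m i) s' \/
                             ~ A m /\ E (fact 1 m i) s'].

Lemma ex_step q s : live s -> exists s', step q s s'.
Proof.
case: q => [[[y1 y2] p] i] ls.
have [s1 [[ss1 [_ H1]] ls1]] := live_move y1 y2 p ls.
(* In [move] the choice obligation is guarded by both [y1] and [y2]; repeating [y1] obtains it
   without assuming that [y2] is present. *)
have [s2 [[ss2 [_ H2]] ls2]] := live_move y1 y1 p ls1.
have [s3 [ls3 ss3 H3]] : exists s3, [/\ live s3, forall z, E z s2 -> E z s3 &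
    E (iNm i) s -> exists m, A m /\ E (fact 0 m i) s3 \/
                             ~ A m /\ E (fact 1 m i) s3].
  have [si|nsi] := pselect (E (iNm i) s); last by exists s2.
  have [m H] := not_isolated ls2 (ss2 _ (ss1 _ si)).
  case: H => -[Am lm]; [exists (adj s2 (fact 0 m i)) | exists (adj s2 (fact 1 m i))];
    (split=> // [z|_]; first exact: sub_adj); exists m; [left | right];
    by split=> //; apply: in_adj.
exists s3; split=> // [z zs|y1s y2s Hr|y1s Hr].
- exact/ss3/ss2/ss1.
- by apply/ss3/ss2; apply: (H1 y1s y2s).1.
- have [z [zs2 Hz]] := (H2 (ss1 _ y1s) (ss1 _ y1s)).2 Hr.
  by exists z; split=> //; apply: ss3.
Qed.

(** Each query must recur, since its premises may enter the play late. The query at [n] is decoded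
    from the 2-adic valuation of [n]. *)
Lemma recurrent_enumeration : exists h : nat -> M * M * M * M,
  forall q N, exists2 n, N <= n & h n = q.
Proof.
have /countable_injP[f0 f0inj] := M_countable.
have finj : injective f0 by move=> x y; apply: f0inj; rewrite inE.
pose f (q : M * M * M * M) : nat :=
  pickle (f0 q.1.1.1, f0 q.1.1.2, f0 q.1.2, f0 q.2).
have f_inj : injective f.
  move=> [[[? ?] ?] ?] [[[? ?] ?] ?] /(pcan_inj (@pickleK _)).
  by move=> [/finj -> /finj -> /finj -> /finj ->].
have /boolp.choice[h hP] n : exists p, forall q, f q = logn 2 n -> p = q.
  have [[p Hp]|H] := pselect (exists p, f p = logn 2 n).
    by exists p => q Hq; apply: f_inj; rewrite Hp Hq.
  by exists (emp, emp, emp, emp) => q Hq; case: H; exists q.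
(* The odd factor [N.*2.+1] pushes the index beyond [N] without changing its valuation [f q]. *)
exists h => q N; exists (2 ^ f q * N.*2.+1).
  by rewrite (leq_trans _ (leq_pmull _ _)) ?expn_gt0 // -addnn -addSn leq_addl.
apply: hP; rewrite lognM ?expn_gt0 // pfactorK // lognE /= dvdn2 /= odd_double.
by rewrite addn0.
Qed.

Lemma ex_branch : exists S : M -> Prop,
  [/\ S (iNm emp), S (iEnv emp),
    forall y1 y2, S y1 -> S y2 -> ~ clash y1 y2,
    forall y1 y2 p, S y1 -> S y2 -> rule y1 y2 p -> S p &
    (forall y p, S y -> (exists z, choice_rule y p z) ->
      exists2 z, S z & choice_rule y p z) /\
    (forall i, S (iNm i) -> exists m, A m /\ S (fact 0 m i) \/
                                      ~ A m /\ S (fact 1 m i))].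
Proof.
have /boolp.choice[F HF] (qs : M * M * M * M * M) :
    exists s', live qs.2 -> step qs.1 qs.2 s'.
  have [/(ex_step qs.1)[s' Hs']|nls] := pselect (live qs.2); last by exists emp.
  by exists s'.
have [h hP] := recurrent_enumeration.
pose sigma := fix sigma n := if n is n.+1 then F (h n, sigma n) else start.
have lsig n : live (sigma n).
  elim: n => // n IH /=; have := HF (h n, sigma n) IH.
  by case: (h n) => [[[? ?] ?] ?] [].
have stepS n : step (h n) (sigma n) (sigma n.+1) := HF (h n, sigma n) (lsig n).
have mono n m z : n <= m -> E z (sigma n) -> E z (sigma m).
  move=> /subnK <-; elim: (m - n) => // k IH /IH zk; rewrite addSn.
  by have := stepS (k + n); case: (h _) => [[[? ?] ?] ?] [_ H _ _ _]; apply: H.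
exists (fun z => exists n, E z (sigma n)); split.
- by exists 0; apply/sub_adj/in_adj.
- by exists 0; apply/in_adj.
- move=> y1 y2 [n1 H1] [n2 H2]; apply: (live_clash (lsig (maxn n1 n2))).
    exact: mono (leq_maxl _ _) H1.
  exact: mono (leq_maxr _ _) H2.
- move=> y1 y2 p [n1 H1] [n2 H2] Hr.
  have [n nn hn] := hP (y1, y2, p, p) (maxn n1 n2).
  exists n.+1; have := stepS n; rewrite hn => -[_ _ H _ _]; apply: H => //.
    exact: mono (leq_trans (leq_maxl _ _) nn) H1.
  exact: mono (leq_trans (leq_maxr _ _) nn) H2.
split.
- move=> y p [n1 H1] Hr; have [n nn hn] := hP (y, y, p, p) n1.
  have := stepS n; rewrite hn => -[_ _ _ H _].
  have [z [zn Hz]] := H (mono _ _ _ nn H1) Hr.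
  by exists z => //; exists n.+1.
- move=> i [n1 H1]; have [n nn hn] := hP (i, i, i, i) n1.
  have := stepS n; rewrite hn => -[_ _ _ _ H].
  have [m Hm] := H (mono _ _ _ nn H1); exists m.
  by case: Hm => -[? ?]; [left | right]; split=> //; exists n.+1.
Qed.

End Branch.

(** * The realization read off a play *)

Section Branch_realization.
Variable S : M -> Prop.
Hypothesis S_emp : S (iNm emp).
Hypothesis S_env : S (iEnv emp).
Hypothesis S_clash : forall y1 y2, S y1 -> S y2 -> ~ clash y1 y2.
Hypothesis S_rule : forall y1 y2 p, S y1 -> S y2 -> rule y1 y2 p -> S p.
Hypothesis S_choice : forall y p, S y -> (exists z, choice_rule y p z) ->
  exists2 z, S z & choice_rule y p z.

Definition named_class (i : M) : set M :=
  [set m | exists e f, [/\ S (iFt (num 1) cSC e f), pfst e = m & pfst f = i]].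

Definition branch_classes : set (set M) :=
  [set B | exists2 i, S (iNm i) & B = named_class i].

Local Notation Y := branch_classes.
Local Notation Z := named_class.

(** The derivation is an external, well-founded object, so finitely many uses of [rule_grade]
    reproduce it in [S]. *)
Lemma branch_graded g phi : graded g phi -> S (iGr (num g) (code phi)).
Proof.
have low k : k <= 1 -> num k = num 0 \/ num k = num 1.
  by case: k => [|[|]] // _; [left | right].
have grade y1 y2 g' x : S y1 -> S y2 -> rule_grade y1 y2 g' x -> S (iGr g' x).
  by move=> S1 S2 H; apply: (S_rule S1 S2); left; exists g', x.
elim=> {g phi}.
- move=> g Hg; apply: (grade _ _ _ _ S_emp S_emp).
  by left; split; [exact: low | left; left].
- move=> g Hg; apply: (grade _ _ _ _ S_emp S_emp).
  by left; split; [exact: low | left; right; left].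
- move=> g Hg; apply: (grade _ _ _ _ S_emp S_emp).
  by left; split; [exact: low | left; right; right].
- move=> g p q Hg _ Sp _ Sq; apply: (grade _ _ _ _ Sp Sq).
  left; split; [exact: low | right; exists (code p); split=> //].
  by do 3 right; right; exists (code q).
- move=> g p Hg _ Sp; apply: (grade _ _ _ _ Sp Sp).
  by left; split; [exact: low | right; exists (code p); split=> //; left].
- move=> g p Hg _ Sp; apply: (grade _ _ _ _ Sp Sp).
  by left; split; [exact: low | right; exists (code p); split=> //; right; left].
- move=> g p Hg _ Sp; apply: (grade _ _ _ _ Sp Sp).
  left; split; [exact: low | right; exists (code p); split=> //].
  by right; right; left.
- move=> g p Hg _ Sp; apply: (grade _ _ _ _ Sp Sp).
  left; split; [exact: low | right; exists (code p); split=> //].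
  by do 3 right; left.
- move=> p _ Sp; apply: (grade _ _ _ _ Sp Sp).
  by right; left; split=> //; exists (code p).
- move=> g p _ Sp; apply: (grade _ _ _ _ Sp Sp).
  do 2 right; left; exists (num g.+1), (code p).
  by split=> //; apply: pr_neq_emp.
- move=> g p _ Sp; apply: (grade _ _ _ _ Sp Sp).
  do 3 right; split; first exact: pr_neq_emp.
  by split; [move=> /num_inj | exists (code p)].
Qed.

(** The truth lemma for Hintikka sets, by induction on an actual formula; both truth values go
    together because implication exchanges them. *)
Lemma branch_truth phi : forall e f,
  (S (iFt (num 1) (code phi) e f) -> ssat E Y (ev e) (fun n => Z (ev f n)) phi) /\
  (S (iFt (num 0) (code phi) e f) -> ~ ssat E Y (ev e) (fun n => Z (ev f n)) phi).
Proof.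
elim: phi => [| | |p IHp q IHq|p IHp|p IHp|p IHp|p IHp|p IHp] e f /=.
- split=> Sx; first apply: contrapT; move=> H; apply: (S_clash Sx Sx);
    exists e, f, e, f; by [right; left | do 2 right; left].
- split=> Sx; first by exists e, f.
  move=> [e' [f' [Sx' ee ff]]]; apply: (S_clash Sx' Sx).
  by exists e', f', e, f; left.
- split=> Sx //; apply: (S_clash Sx Sx).
  by exists e, f, e, f; do 3 right.
- split=> Sx.
    have [|z Sz Hz] := @S_choice _ emp Sx.
      eexists; left; exists (code p), (code q), e, f; split=> //; left; reflexivity.
    have [zE|zE] : z = iFt (num 0) (code p) e f \/ z = iFt (num 1) (code q) e f.
      case: Hz => [[x [w [e' [f' [H Hz]]]]]|]; first by pair_inv.
      by case=> [[? [? [? [? [H _]]]]]|[[? [? [? [? [H _]]]]]|[? [H _]]]]; pair_inv.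
    + by subst z => Hp; case: ((IHp e f).2 Sz).
    + by subst z => _; apply: (IHq e f).1.
  move=> H; apply: (IHq e f).2 _ (H _).
    apply: (S_rule Sx Sx); do 4 right; left.
    by exists (code p), (code q), e, f; split=> //; right.
  apply: (IHp e f).1.
  apply: (S_rule Sx Sx); do 4 right; left.
  by exists (code p), (code q), e, f; split=> //; left.
- split=> Sx.
    move=> a; rewrite -ev_pr; apply: (IHp _ _).1.
    by apply: (S_rule Sx Sx); do 5 right; left; exists (code p), e, f, a.
  have [|z Sz Hz] := @S_choice _ emp Sx.
    eexists; right; left; exists (code p), e, f, e; split=> //; reflexivity.
  have [a zE] : exists a, z = iFt (num 0) (code p) (pr a e) f.
    case: Hz => [[? [? [? [? [H _]]]]]|]; first by pair_inv.
    case=> [[x [e' [f' [a [H ->]]]]]|]; first by exists a; pair_inv.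
    by case=> [[? [? [? [? [H _]]]]]|[? [H _]]]; pair_inv.
  by subst z => H; apply: (IHp _ _).2 Sz _; rewrite ev_pr.
- split=> Sx.
    move=> B [j Sj ->]; have := (IHp e (pr j f)).1.
    rewrite ev_pr scons_comp; apply.
    by apply: (S_rule Sx Sj); do 6 right; left; exists (code p), e, f, j.
  have [|z Sz Hz] := @S_choice _ emp Sx.
    eexists; right; right; left; exists (code p), e, f, e; split=> //; reflexivity.
  have [j zE] : exists j, z = iFt (num 0) (code p) e (pr j f).
    case: Hz => [[? [? [? [? [H _]]]]]|]; first by pair_inv.
    case=> [[? [? [? [? [H _]]]]]|]; first by pair_inv.
    case=> [[x [e' [f' [j [H ->]]]]]|[? [H _]]]; last by pair_inv.
    by exists j; pair_inv.
  subst z => H; have := (IHp e (pr j f)).2 Sz.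
  rewrite ev_pr scons_comp; apply; apply: H; exists j => //.
  (* A counterexample to a class quantifier counts only if its name is declared, which the last
     clause of [rule] ensures. *)
  have := S_rule (p := iNm (pfst (pr j f))) Sz Sz; rewrite pfst_pr; apply.
  by do 10 right; exists (num 0), (code p), e, (pr j f); rewrite pfst_pr.
- rewrite -ev_swapc; split=> Sx; [apply: (IHp _ _).1 | apply: (IHp _ _).2];
    apply: (S_rule Sx Sx); do 7 right; left; eexists; exists (code p), e, f;
    split; reflexivity.
- rewrite -ev_snd; split=> Sx; [apply: (IHp _ _).1 | apply: (IHp _ _).2];
    apply: (S_rule Sx Sx); do 8 right; left; eexists; exists (code p), e, f;
    split; reflexivity.
- have -> : (fun n => Z (ev f n.+1)) = (fun n => Z (ev (psnd f) n)).
    by rewrite ev_snd.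
  split=> Sx; [apply: (IHp _ _).1 | apply: (IHp _ _).2];
    apply: (S_rule Sx Sx); do 9 right; left; eexists; exists (code p), e, f;
    split; reflexivity.
Qed.

Lemma ex_ev (v : nat -> M) N : exists e, forall n, n < N -> v n = ev e n.
Proof.
elim: N v => [|N IH] v; first by exists emp.
have [e He] := IH (fun n => v n.+1); exists (pr (v 0) e) => -[|n] Hn;
  by rewrite ev_pr //=; apply: He.
Qed.

Lemma ex_class_ev (V : nat -> set M) N : (forall n, Y (V n)) ->
  exists2 f, S (iEnv f) & forall n, n < N -> V n = Z (ev f n).
Proof.
elim: N V => [|N IH] V YV; first by exists emp.
have [f Sf Hf] := IH (fun n => V n.+1) (fun n => YV n.+1).
have [j Sj Vj] := YV 0; exists (pr j f).
  by apply: (S_rule Sj Sf); right; left; exists j, f.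
by move=> [|n] Hn; rewrite ev_pr //=; apply: Hf.
Qed.

Lemma branch_ax : exists v V, ssat E Y v V ax.
Proof.
exists (ev emp), (fun n => Z (ev emp n)); apply: (branch_truth _ _ _).1.
by apply: (S_rule S_env S_env); do 2 right; left.
Qed.

(** Parameters are replaced by coded lists agreeing with them up to the bound of [ssat_local]; the
    comprehension clause of [rule] and the truth lemma then supply the class. *)
Lemma branch_comp psi : graded kappa psi ->
  forall v V, (forall n, Y (V n)) -> Y [set a | ssat E Y (scons a v) V psi].
Proof.
move=> /branch_graded Sg v V YV; have [N HN] := ssat_local E Y psi.
have [e He] := ex_ev v N; have [f Sf Hf] := ex_class_ev N YV.
have : ssat E Y (ev e) (fun n => Z (ev f n)) (scomp psi).
  apply: (branch_truth _ _ _).1; apply: (S_rule Sg Sf); do 3 right; left.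
  by exists (code psi), e, f.
move=> /ssat_comp[B YB HB]; congr Y: YB; rewrite predeqE => a; rewrite HB /=.
by apply: HN => n Hn; [case: n Hn => //= n /ltnW /He | rewrite Hf].
Qed.

Lemma branch_nonempty : Y !=set0.
Proof. by exists (Z emp), emp. Qed.

Lemma branch_omits A :
  (forall i, S (iNm i) -> exists m, A m /\ S (fact 0 m i) \/
                                    ~ A m /\ S (fact 1 m i)) -> ~ Y A.
Proof.
move=> H [i /H[m [[Am Sm]|[nAm Sm]]] AE]; last first.
  by apply: nAm; rewrite AE; exists (pr m emp), (pr i emp); rewrite !pfst_pr.
move: Am; rewrite AE => -[e [f [Sx em fi]]]; apply: (S_clash Sx Sm).
by exists e, f, (pr m emp), (pr i emp); left; rewrite !pfst_pr.
Qed.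

End Branch_realization.

(** The class of [X] that the new realization omits is [diagonal]. *)
Lemma ex_realization_not_above X :
  countable [set: M] -> X !=set0 ->
  (forall P, definable E true P ->
    forall v V, (forall n, X (V n)) -> X [set a | P X (scons a v) V]) ->
  (forall P, definable E true P -> forall v V, (forall n, X (V n)) ->
    X [set a | forall A, X A -> P X (scons a v) (scons A V)]) ->
  (forall v V, (forall n, X (V n)) -> ssat E X v V ax) ->
  (forall psi, graded kappa psi -> forall v V, (forall n, X (V n)) ->
    X [set a | ssat E X (scons a v) V psi]) ->
  exists Y, [/\ ~ X `<=` Y, Y !=set0, exists v V, ssat E Y v V ax &
    forall psi, graded kappa psi -> forall v V, (forall n, Y (V n)) ->
      Y [set a | ssat E Y (scons a v) V psi]].
Proof.
move=> Mc X_ne X_fo X_pi X_ax X_comp.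
have [S [Semp Senv Scl Srule [Schoice Sdiag]]] := ex_branch Mc
  (live_start X_ax X_comp X_ne) (diagonal_not_isolated X_fo X_pi X_ne).
exists (branch_classes S); split.
- move=> XY; apply: (branch_omits Scl Sdiag); apply: XY.
  exact: X_diagonal.
- exact: branch_nonempty.
- exact: branch_ax.
- exact: branch_comp.
Qed.

End Game.

(** * From graded comprehension back to the two theories *)

Section LeastRealization.
Variables (M : Type) (E : M -> M -> Prop).
Hypothesis zfc : ZFC E.

Let ext := ZFC_extensionality zfc.
Let fnd := ZFC_foundation zfc.
Let pai := ZFC_pairing zfc.

Definition graded_comprehension (kappa : nat) (X : set (set M)) : Prop :=
  forall psi, graded kappa psi -> forall v V, (forall n, X (V n)) ->
    X [set a | ssat E X (scons a v) V psi].

Lemma graded_comprehension0 X :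
  comprehension E X (fun _ => True) <-> graded_comprehension 0 X.
Proof.
split=> H phi Hphi v V XV.
  have := H (back phi) I v V XV; congr X.
  by rewrite predeqE => a /=; rewrite ssat_back.
have := H (tr phi) (graded0 _) v V XV; congr X.
by rewrite predeqE => a /=; rewrite ssat_tr.
Qed.

Lemma graded_comprehensionS k X :
  comprehension E X (Pi1 k) <-> graded_comprehension k.+1 X.
Proof.
split=> H phi Hphi v V XV.
  have [[psi Hpsi Heq] _] := Pi1_of_graded E Hphi.
  have := H _ Hpsi v V XV; congr X.
  by rewrite predeqE => a /=; rewrite Heq.
have [psi Hpsi Heq] := (graded_of_Pi1 ext fnd pai k).1 _ Hphi.
have := H _ Hpsi v V XV; congr X.
by rewrite predeqE => a /=; rewrite Heq.
Qed.

Lemma comprehension_pad k X : X !=set0 ->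
  comprehension E X (Pi1 k) -> comprehension E X first_order.
Proof.
move=> X0 H phi Hphi v V XV; have [[psi Hpsi Heq] _] := pad_first_order E k Hphi.
have := H _ Hpsi v V XV; congr X.
by rewrite predeqE => a /=; rewrite Heq.
Qed.

Lemma global_choice_nonempty X : global_choice E X -> X !=set0.
Proof. by move=> [F [XF _ _ _ _]]; exists F. Qed.

(** Class Replacement and Global Choice are packed into the one axiom of the game, and the remaining
    schema is comprehension at grade [kappa]. The play yields a realization omitting a class of the
    supposed least one. *)
Lemma no_least_graded kappa (T : set (set M) -> Prop) :
  countable [set: M] ->
  (forall X, T X <-> [/\ class_replacement E X, global_choice E X &
                       graded_comprehension kappa X]) ->
  (forall X, T X -> comprehension E X first_order) ->
  (forall X, T X -> comprehension E X
     (fun phi => exists2 psi, first_order psi & phi = ClassAll psi)) ->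
  ~ exists X, least_realization T X.
Proof.
move=> Mc HT Tfo Tpi [X [TX Xmin]].
have [phi _ Hphi] := definable_and (definable_class_replacement E)
  (definable_global_choice E).
have [XR XG XC] := (HT X).1 TX.
(* The truth of the axiom does not depend on the assignment, so having it under one assignment, as
   the play gives, is enough. *)
have axP Y v V : ssat E Y v V (tr phi) <->
    class_replacement E Y /\ global_choice E Y by rewrite ssat_tr.
have [|P [psi Hpsi Heq] v V XV|P [psi Hpsi Heq] v V XV|v V _| |
      Y [XY Y0 [v [V /axP[YR YG]]] YC]] :=
  @ex_realization_not_above M E zfc kappa (tr phi) X Mc.
- exact: global_choice_nonempty XG.
- have := Tfo _ TX psi (Hpsi isT) v V XV; congr X.
  by rewrite predeqE => a /=; rewrite Heq.
- have := Tpi _ TX (ClassAll psi) _ v V XV.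
  move=> /(_ (ex_intro2 _ _ psi (Hpsi isT) erefl)); congr X.
  by rewrite predeqE => a /=; split=> H A XA; apply/Heq; apply: H.
- by apply/axP.
- exact: XC.
- by apply: XY; apply: Xmin; apply/HT.
Qed.

Lemma GBC_intro X : class_replacement E X -> global_choice E X ->
  comprehension E X first_order -> GBC E X.
Proof.
by move=> *; split=> // A B _ _ AB; rewrite predeqE.
Qed.

End LeastRealization.

Unset Implicit Arguments.

Theorem theorem4p5 (M : Type) (E : M -> M -> Prop)
    (M_countable : countable [set: M]) (M_ZFC : ZFC E) :
  (~ exists X : set (set M), least_realization (fun Y => KM E Y) X) /\
  (forall k : nat, (1 <= k)%N ->
     ~ exists X : set (set M),
         least_realization (fun Y => GBC_Pi1_CA E Y k) X).
Proof.
split=> [|[//|k] _].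
- apply: (no_least_graded M_ZFC (kappa := 0)) => // X.
  + split=> [[G /(graded_comprehension0 M_ZFC)]|[XR XG]].
      by split=> //; [apply: GBC_replacement G | apply: GBC_global_choice G].
    move=> /(graded_comprehension0 M_ZFC) XC; split=> //.
    by apply: GBC_intro => // phi _; apply: XC.
  + by case=> _ XC phi _; apply: XC.
  + by case=> _ XC phi _; apply: XC.
(* The exponent is now [k.+1], and [Pi1 k.+1] corresponds to grade [k.+2]. *)
- apply: (no_least_graded M_ZFC (kappa := k.+2)) => // X.
  + split=> [[G /(graded_comprehensionS M_ZFC)]|[XR XG]].
      by split=> //; [apply: GBC_replacement G | apply: GBC_global_choice G].
    move=> /(graded_comprehensionS M_ZFC) XC; split=> //.
    (* Elementary Comprehension follows by padding; the class that padding requires comes from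
       Global Choice. *)
    apply: GBC_intro => //; apply: (comprehension_pad (k := k.+1)) XC.
    exact: global_choice_nonempty XG.
  + by case=> G _; apply: GBC_comprehension G.
  + case=> G XC _ [psi Hpsi ->] v V XV.
    (* Padding the matrix to [Sigma1 k] turns a single universal class quantifier over it into a
       [Pi1 k.+1] formula. *)
    have [_ [psi' S1 Heq]] := pad_first_order E k Hpsi.
    have := XC (ClassAll psi') (@Pi1_S k 0 _ S1) v V XV; congr X.
    have X0 := global_choice_nonempty (GBC_global_choice G).
    rewrite predeqE => a /=.
    by split=> H A XA; apply/Heq => //; apply: H.
Qed.
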